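(* In the setting described in the context, suppose in addition that there exists $G>0$ such that $\|\nabla\Phi_t(u)\|\le G$ for all $t\in\mathbb{N}$ and all $u\in\mathbb{R}^p$. For even $T\ge2$ let $$\mathcal{R}_1^{\mathrm{even}}(T)=\sum_{t\in[T]_2}\mathbb{E}\big[\|\nabla\Phi_t(u_t)\|^2\big].$$ Then, for every even $T\ge2$, the following bounds hold. (i) Constant probing. If $\delta_t\equiv\delta$, then $$\mathcal{R}_1^{\mathrm{even}}(T)\le G\sqrt{2\pi p}\,\Big[\frac{\Phi_0(u_0)-\Phi_{\mathrm{low}}+2D_T+2B_T}{\delta}+\frac{L}{8}T\delta\Big].$$ In particular, under the choice $\delta=\frac{4\varepsilon}{3\sqrt{2\pi p}\,L}$ with $\varepsilon>0$, $$\mathcal{R}_1^{\mathrm{even}}(T)=\mathcal{O}\Big(T\varepsilon+\frac{p(1+D_T+B_T)}{\varepsilon}\Big).$$ (ii) Diminishing probing. If $\delta_t=\frac{1}{\sqrt{t+1}}$, then $$\mathcal{R}_1^{\mathrm{even}}(T)\le G\sqrt{2\pi pT}\,\Big[\Phi_0(u_0)-\Phi_{\mathrm{low}}+\frac{L}{4}(1+\log T)+2D_T+2B_T\Big].$$ Consequently, $$\mathcal{R}_1^{\mathrm{even}}(T)=\mathcal{O}\big(\sqrt{pT}\,(\log T+D_T+B_T)\big).$$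
   Context: $\mathbb{N}=\{0,1,2,\dots\}$, $p\ge1$ is an integer, $\|\cdot\|$ is the Euclidean norm, and $\log$ is the natural logarithm. For even $T\ge2$, $[T]_2=\{0,2,\dots,T-2\}$. The notation $f(T)=\mathcal{O}(h(T))$ means that there exist constants $c>0$ and $T_0\ge0$ such that $f(T)\le c\,h(T)$ for all $T\ge T_0$. Objectives: for each $t\in\mathbb{N}$, $\Phi_t:\mathbb{R}^p\to\mathbb{R}$ is differentiable with $L$-Lipschitz continuous gradient (same constant $L>0$ for all $t$), and $\Phi_t(u)\ge\Phi_{\mathrm{low}}$ for all $u$ and $t$, with $\Phi_{\mathrm{low}}\in\mathbb{R}$. Inexact oracle: for each $t$, $\tilde\Phi_t:\mathbb{R}^p\to\mathbb{R}$ is a (deterministic) continuous function. Temporal drift: $d_t=\sup_{u\in\mathbb{R}^p}|\Phi_{t+1}(u)-\Phi_t(u)|$, assumed finite for all $t$, and $D_T=\sum_{t=0}^{T-1}d_t$. Oracle error: $b_t=\sup_{u\in\mathbb{R}^p}|\tilde\Phi_t(u)-\Phi_t(u)|$, assumed finite for all $t$, and $B_T=\sum_{t=0}^{T-1}b_t$. Online two-point direct search generating $(u_t)$: given a deterministic $u_0\in\mathbb{R}^p$ and a deterministic sequence of positive probing ratios $\delta_t$, for $t=0,2,4,\dots$: draw $v_t\sim\mathcal{N}(0,\frac1pI_p)$ independently of all previous draws, set $u_{t+1}=u_t+\delta_tv_t$, and set $u_{t+2}=u_{t+1}$ if $\tilde\Phi_{t+1}(u_{t+1})\le\tilde\Phi_t(u_t)$,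 and $u_{t+2}=u_t$ otherwise. $\mathbb{E}$ is expectation over the random directions. *)

(* Defs.v *)
From HB Require Import structures.
From mathcomp Require Import all_boot all_order all_algebra.
From mathcomp Require Import all_classical all_reals all_analysis.

Set Implicit Arguments.
Unset Strict Implicit.
Unset Printing Implicit Defensive.

Import Order.TTheory GRing.Theory Num.Theory.
Import numFieldNormedType.Exports.

Local Open Scope classical_set_scope.
Local Open Scope ring_scope.

Section Euclidean.
Context {R : realType} {p : nat}.
Implicit Types (f g : 'rV[R]_p -> R) (u : 'rV[R]_p).

(* The library norm `|u| on 'rV[R]_p is the sup norm, which has the same
   topology and the same notion of differentiability as the Euclidean one. *)
Definition enorm u : R := Num.sqrt (\sum_(i < p) u 0 i ^+ 2).

Definition grad f u : 'rV[R]_p := \row_(i < p) 'D_(delta_mx 0 i) f u.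

Definition smooth (L : R) f : Prop :=
  (forall u, differentiable f u) /\
  (forall u u', enorm (grad f u - grad f u') <= L * enorm (u - u')).

Definition gaps f g : set R := [set `|f u - g u| | u in [set: 'rV[R]_p]].

(* [sup] is a junk value on an unbounded set: finiteness of the supremum is
   [has_ubound (gaps f g)], assumed wherever [supdist] is used. *)
Definition supdist f g : R := sup (gaps f g).

Definition drift (Phi : nat -> 'rV[R]_p -> R) (T : nat) : R :=
  \sum_(t < T) supdist (Phi t.+1) (Phi t).

Definition oracle_err (tPhi Phi : nat -> 'rV[R]_p -> R) (T : nat) : R :=
  \sum_(t < T) supdist (tPhi t) (Phi t).

Definition borel : set_system 'rV[R]_p := <<s [set U | open U] >>.

End Euclidean.

Section RandomDirections.
Context {R : realType} {p : nat} {d : measure_display} {Omega : measurableType d}.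
Variable P : probability Omega R.

(* X ~ N(0, s2 I_p): its law is the p-fold product of N(0, s2). The second
   parameter of [normal_prob] is the standard deviation. *)
Definition isotropic_gaussian (s2 : R) (X : Omega -> 'rV[R]_p) : Prop :=
  (forall B, borel B -> measurable (X @^-1` B)) /\
  (forall A : 'I_p -> set R, (forall i, measurable (A i)) ->
     P [set w | forall i, A i (X w 0 i)] =
     (\prod_(i < p) normal_prob 0 (Num.sqrt s2) (A i))%E).

Definition past_draws (v : nat -> Omega -> 'rV[R]_p) (t : nat) :
    set_system Omega :=
  <<s \bigcup_(s in [set s | (s < t)%N && ~~ odd s])
        preimage_set_system setT (v s) borel >>.

(* Only the directions of even index are drawn; those of odd index are
   irrelevant. *)
Definition gaussian_directions (v : nat -> Omega -> 'rV[R]_p) : Prop :=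
  forall t, ~~ odd t ->
    isotropic_gaussian p%:R^-1 (v t) /\
    (forall A B, preimage_set_system setT (v t) borel A -> past_draws v t B ->
       P (A `&` B) = (P A * P B)%E).

Record direct_search (tPhi : nat -> 'rV[R]_p -> R) (u0 : 'rV[R]_p)
    (delta : nat -> R) (v u : nat -> Omega -> 'rV[R]_p) : Prop := DirectSearch {
  ds_init : forall w, u 0%N w = u0;
  ds_probe : forall t w, ~~ odd t -> u t.+1 w = u t w + delta t *: v t w;
  ds_update : forall t w, ~~ odd t ->
    u t.+2 w = if tPhi t.+1 (u t.+1 w) <= tPhi t (u t w)
               then u t.+1 w else u t w }.

Definition R1_even (Phi : nat -> 'rV[R]_p -> R) (u : nat -> Omega -> 'rV[R]_p)
    (T : nat) : \bar R :=
  (\sum_(t < T | ~~ odd t)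
     'E_P[fun w => (enorm (grad (Phi t) (u t w)) ^+ 2)%R])%E.

End RandomDirections.

(* Main.v *)
Require Import Defs.
From HB Require Import structures.
From mathcomp Require Import all_boot all_order all_algebra.
From mathcomp Require Import all_classical all_reals all_analysis.
From mathcomp Require Import measurable_realfun normal_distribution.
From mathcomp Require Import ring lra.

Import Order.TTheory GRing.Theory Num.Theory.
Import numFieldNormedType.Exports.

Local Open Scope classical_set_scope.
Local Open Scope ring_scope.

(** Write g for the gradient of Phi_t at u_t and x^- for max(-x, 0). A round
    compares two noisy values taken at two different times, so up to the drift
    and oracle errors of the round it moves to the better of u_t and
    u_t + delta v. By the descent inequality for an L-smooth function this
    gives, along every trajectory,

      Phi_{t+2}(u_{t+2}) + delta <g,v>^-
        <= Phi_t(u_t) + (L/2) delta^2 |v|^2 1_{<g,v> < 0} + errors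

    ([direct_search_step]). The indicator matters: when v points uphill the
    comparison is made with staying at u_t, and no curvature is paid. This is
    what turns L/4 into the L/8 of the constant-step bound.

    After subtracting Phi_low every term is nonnegative, so the inequality can
    be integrated in [0, +oo] and telescoped without discussing
    integrability. The iterate u_t depends on the earlier draws only, and v_t
    is independent of them; by Fubini ([ge0_integral_past]) g may be treated
    as a constant vector when integrating over v_t ~ N(0, I/p). Two
    computations remain:
    - E <g,v>^- = |g| / sqrt(2 pi p), because <g,v> is distributed as |g| times
      a single coordinate of v ([ge0_integral_gaussian_dot],
      [integral_gaussian_dot_negpart]);
    - E |v|^2 1_{<g,v> < 0} <= 1/2, because v and -v have the same law and the
      two open half spaces are disjoint
      ([integral_gaussian_halfspace_sqnorm_le]).

    Telescoping bounds the sum of delta_t E|g_t|, and |g_t|^2 <= G |g_t|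
    together with a lower bound on the steps turns this into [R1_even_le]. Both
    step-size rules are instances: the constant one sums T/2 equal squares, the
    diminishing one sums 1/(t+1), which is at most 1 + log T. *)

(** * Integration against a normal law *)

Section AffineSubstitution.
Context {R : realType}.
Variables (a c : R).
Hypothesis a_neq0 : a != 0.
Local Notation mu := (@lebesgue_measure R).
Let phi (x : measurableTypeR R) : measurableTypeR R := a * x + c.

Lemma measurable_affine : measurable_fun setT phi.
Proof. by apply: measurable_funD => //; exact: measurable_funM. Qed.

Let push : {measure set (measurableTypeR R) -> \bar R} :=
  @measure_function_pushforward__canonical__measure_function_Measure _ _ _ _ R
    mu _ measurable_affine.
Let nu : {measure set (measurableTypeR R) -> \bar R} :=
  mscale (NngNum (normr_ge0 a)) push.

Let lebesgue_nu A : measurable A -> mu A = nu A.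
Proof.
apply: lebesgue_measure_unique => X [[u v] /= uv <-].
rewrite /mscale/= /pushforward.
have [a_gt0|a_le0] := ltP 0 a.
  have -> : phi @^-1` `]u, v]%classic = `](u - c) / a, (v - c) / a]%classic.
    apply/seteqP; split => x /=; rewrite !in_itv/= /phi ltr_pdivrMr//
      ler_pdivlMr//; by rewrite ltrBlDr lerBrDr mulrC.
  rewrite !lebesgue_measure_itv/= !lte_fin ltr_pM2r ?invr_gt0// ltrD2r.
  case: ifPn => _; rewrite ?mule0//; congr EFin.
  by rewrite gtr0_norm//; field.
have a_lt0 : a < 0 by rewrite lt_neqAle a_neq0.
have -> : phi @^-1` `]u, v]%classic = `[(v - c) / a, (u - c) / a[%classic.
  apply/seteqP; split => x /=; rewrite !in_itv/= /phi ltr_ndivlMr//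
    ler_ndivrMr//; by rewrite andbC ltrBlDr lerBrDr mulrC.
rewrite !lebesgue_measure_itv/= !lte_fin ltr_nM2r ?invr_lt0// ltrD2r.
case: ifPn => _; rewrite ?mule0//; congr EFin.
by rewrite ltr0_norm//; field.
Qed.

(** Change of variables for merely measurable integrands: Lebesgue measure is
    determined by its values on half-open intervals, where the scaling is
    visible. *)
Lemma ge0_integral_affine (f : R -> \bar R) : measurable_fun setT f ->
  (forall x, 0 <= f x)%E ->
  (\int[mu]_x f x = `|a|%:E * \int[mu]_x f (a * x + c)%R)%E.
Proof.
move=> mf f0.
rewrite (eq_measure_integral nu); last by move=> A mA _; exact: lebesgue_nu.
rewrite ge0_integral_mscale//= ge0_integral_pushforward//.
exact: measurable_affine.
Qed.
End AffineSubstitution.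

Section NormalIntegral.
Context {R : realType}.
Local Notation mu := (@lebesgue_measure R).
Local Open Scope ereal_scope.
Variables m s : R.

Let integral_normal_indic E : measurable E ->
  \int[normal_prob m s]_x (\1_E x)%:E =
  \int[mu]_x ((\1_E x)%:E * (normal_pdf m s x)%:E).
Proof.
move=> mE; rewrite integral_indic// setIT /normal_prob.
rewrite [LHS]integral_mkcond. apply: eq_integral => x _.
by rewrite epatch_indic muleC.
Qed.

Let mpdf : measurable_fun setT (fun x => (normal_pdf m s x)%:E).
Proof. by apply/measurable_EFinP; exact: measurable_normal_pdf. Qed.

Let pdf0 x : 0 <= (normal_pdf m s x)%:E.
Proof. by rewrite lee_fin normal_pdf_ge0. Qed.

Import HBNNSimple.

Let integral_normal_nnsfun (f : {nnsfun _ >-> R}) :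
  \int[normal_prob m s]_x (f x)%:E =
  \int[mu]_x ((f x)%:E * (normal_pdf m s x)%:E).
Proof.
under [LHS]eq_integral do rewrite fimfunE -fsumEFin//.
rewrite [LHS]ge0_integral_fsum//; last 2 first.
  - by move=> r; exact/measurable_EFinP/measurableT_comp.
  - by move=> n x _; rewrite EFinM nnfun_muleindic_ge0.
under [RHS]eq_integral.
  move=> x xD; rewrite fimfunE -fsumEFin// muleC ge0_mule_fsumr; last first.
    by move=> r; rewrite EFinM nnfun_muleindic_ge0.
  over.
rewrite [RHS]ge0_integral_fsum//; last 2 first.
  - move=> r; apply: emeasurable_funM => //.
    by apply/measurable_EFinP; do 2 apply/measurableT_comp => //.
  - by move=> n x _; rewrite EFinM mule_ge0//; rewrite nnfun_muleindic_ge0.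
apply: eq_fsbigr => r _.
rewrite integralZl_indic_nnsfun//= integral_normal_indic//.
under [RHS]eq_integral do rewrite EFinM muleCA.
have [r0|r0] := leP 0%R r.
  rewrite ge0_integralZl//.
  - by congr (_ * _); apply: eq_integral => x _; rewrite muleC.
  - apply: emeasurable_funM => //; exact/measurable_EFinP.
  - by move=> x _; rewrite mule_ge0// lee_fin.
have -> : f @^-1` [set r] = set0 by rewrite preimage_nnfun0.
rewrite !indic0 /=; under eq_integral do rewrite mul0e.
by under [RHS]eq_integral do rewrite mule0 mule0; rewrite !integral0 mule0.
Qed.

(** Monotone approximation by simple functions reduces this to indicators,
    where it is the definition of [normal_prob]. *)
Lemma ge0_integral_normal (f : measurableTypeR R -> \bar R) :
  measurable_fun setT f -> (forall x, 0 <= f x) ->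
  \int[normal_prob m s]_x f x = \int[mu]_x (f x * (normal_pdf m s x)%:E).
Proof.
move=> mf f0.
pose f_ := nnsfun_approx measurableT mf.
transitivity (lim (\int[normal_prob m s]_x (f_ n x)%:E @[n --> \oo])).
  rewrite -monotone_convergence//=.
  - apply: eq_integral => ? /[!inE] xD; apply/esym/cvg_lim => //=.
    exact: cvg_nnsfun_approx.
  - by move=> n; exact/measurable_EFinP/measurable_funTS.
  - by move=> n ? _; rewrite lee_fin.
  - by move=> ? _ ? ? mn; rewrite lee_fin; exact/lefP/nd_nnsfun_approx.
rewrite [RHS](_ : _ = lim
    (\int[mu]_x ((f_ n x)%:E * (normal_pdf m s x)%:E) @[n --> \oo]));
  last first.
  rewrite -monotone_convergence//=.
  - apply: eq_integral => x _; apply/esym/cvg_lim => //.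
    apply: cvgeZr => //; exact: cvg_nnsfun_approx.
  - by move=> n; apply: emeasurable_funM => //; exact/measurable_EFinP.
  - by move=> n x _; rewrite mule_ge0// lee_fin.
  - move=> x _ i j ij; apply: lee_wpmul2r => //; rewrite lee_fin.
    exact/lefP/nd_nnsfun_approx.
by apply: congr_lim; apply/funext => n /=; exact: integral_normal_nnsfun.
Qed.

End NormalIntegral.

(** * Stability of centred normal laws *)

Section NormalStability.
Context {R : realType}.
Local Notation mu := (@lebesgue_measure R).
Variable s : R.
Hypothesis s_gt0 : 0 < s.
Local Notation N := (normal_prob 0 s).
Local Notation pdf := (normal_pdf 0 s).

Let s_neq0 : s != 0. Proof. by rewrite gt_eqF. Qed.

Lemma ge0_integral_normal_opp (f : measurableTypeR R -> \bar R) :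
  measurable_fun setT f -> (forall x, 0 <= f x)%E ->
  (\int[N]_x f (- x)%R = \int[N]_x f x)%E.
Proof.
move=> mf f0; rewrite !ge0_integral_normal//; last first.
  exact: measurableT_comp.
rewrite [RHS](@ge0_integral_affine _ (-1) 0) ?oppr_eq0 ?oner_eq0//.
- rewrite normrN1 mul1e; apply: eq_integral => x _.
  by rewrite mulN1r addr0 !normal_pdfE// /normal_fun !subr0 sqrrN.
- apply: emeasurable_funM => //; apply/measurable_EFinP.
  exact: measurable_normal_pdf.
- by move=> x; rewrite mule_ge0// lee_fin normal_pdf_ge0.
Qed.

(** Bayes' rule for X, Y independent N(0, s^2) and Z = a X + b Y: the joint
    density of (Z, Y) is the density of Z times the conditional density of Y
    given Z = z, which is normal with mean b z / r^2 and deviation s a / r. *)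
Let pdf_convolution (a b z y : R) : 0 < a ->
  let r := Num.sqrt (a ^+ 2 + b ^+ 2) in
  pdf ((z - b * y) / a) * pdf y =
  a / r * pdf (z / r) * normal_pdf (b * z / r ^+ 2) (s * a / r) y.
Proof.
move=> a0 r.
have r2 : r ^+ 2 = a ^+ 2 + b ^+ 2 by rewrite sqr_sqrtr ?addr_ge0 ?sqr_ge0.
have r0 : 0 < r by rewrite sqrtr_gt0 ltr_pwDl ?sqr_ge0 ?exprn_gt0.
have [r_neq0 a_neq0] : r != 0 /\ a != 0 by rewrite !gt_eqF.
have t_neq0 : s * a / r != 0 by rewrite !mulf_neq0 ?invr_eq0.
rewrite !normal_pdfE// /normal_fun !subr0.
have peakM : normal_peak (s * a / r) = r / a * normal_peak s.
  rewrite /normal_peak.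
  have -> : (s * a / r) ^+ 2 * pi *+ 2 = (a / r) ^+ 2 * (s ^+ 2 * pi *+ 2).
    by rewrite !mulr2n; field.
  rewrite sqrtrM ?sqr_ge0// sqrtr_sqr gtr0_norm ?divr_gt0//.
  by rewrite invfM invf_div.
rewrite peakM mulrACA -expRD.
transitivity (normal_peak s * normal_peak s *
   (expR (- (z / r) ^+ 2 / (s ^+ 2 *+ 2)) *
    expR (- (y - b * z / r ^+ 2) ^+ 2 / ((s * a / r) ^+ 2 *+ 2)))).
  congr *%R; rewrite -expRD; congr expR.
  (* completing the square: both exponents agree once r^2 = a^2 + b^2 *)
  apply/eqP; rewrite -[s ^+ 2 *+ 2]mulr_natr -[_ ^+ 2 *+ 2]mulr_natr.
  rewrite -subr_eq0 (_ : _ - _ =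
    (a ^+ 2 + b ^+ 2 - r ^+ 2) *
      ((z ^+ 2 / r ^+ 2 - y ^+ 2) / (s ^+ 2 * a ^+ 2 * 2))).
    by rewrite r2 subrr mul0r.
  by field; rewrite ?s_neq0 ?r_neq0 ?a_neq0.
by field; rewrite r_neq0 a_neq0.
Qed.

(** The substitution z = a x + b y in the inner integral and an exchange of
    the integrals bring in [pdf_convolution]; the conditional density of y
    then integrates to 1. *)
Lemma ge0_integral_normal_comb_gt0 (a b : R) (f : measurableTypeR R -> \bar R) :
  0 < a -> measurable_fun setT f -> (forall x, 0 <= f x)%E ->
  (\int[N]_y \int[N]_x f (a * x + b * y)%R =
   \int[N]_z f (Num.sqrt (a ^+ 2 + b ^+ 2) * z)%R)%E.
Proof.
move=> a0 mf f0; set r := Num.sqrt _.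
have r0 : 0 < r by rewrite sqrtr_gt0 ltr_pwDl ?sqr_ge0 ?exprn_gt0.
have a_neq0 : a != 0 by rewrite gt_eqF.
have r_neq0 : r != 0 by rewrite gt_eqF.
have mpdf : measurable_fun setT pdf by exact: measurable_normal_pdf.
have pdf0 x : (0 <= (pdf x)%:E)%E by rewrite lee_fin normal_pdf_ge0.
pose g (z y : R) : R := pdf ((z - b * y) / a) * pdf y.
have g0 z y : 0 <= g z y by rewrite mulr_ge0 ?normal_pdf_ge0.
have mg : measurable_fun setT (fun zy : R * R => g zy.1 zy.2).
  apply: measurable_funM; last exact: measurableT_comp.
  apply: measurableT_comp => //; apply: measurable_funM => //.
  by apply: measurable_funB => //; exact: measurable_funM.
have mgy y : measurable_fun setT (fun z : R => g z y).
  by have := measurableT_comp mg (pair2_measurable y).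
have mgz z : measurable_fun setT (fun y : R => g z y).
  by have := measurableT_comp mg (pair1_measurable z).
have inner y : (\int[N]_x f (a * x + b * y)%R * (pdf y)%:E =
   a^-1%:E * \int[mu]_z (f z * (g z y)%:E))%E.
  have mfa : measurable_fun setT (fun x : R => f (a * x + b * y)).
    apply: measurableT_comp => //; exact: measurable_affine.
  rewrite ge0_integral_normal// [in RHS](@ge0_integral_affine _ a (b * y)) //.
  - rewrite gtr0_norm// muleA -EFinM mulVf// mul1e -ge0_integralZr//.
    + apply: eq_integral => x _; rewrite -muleA -EFinM /g.
      by rewrite addrK mulrAC mulfV// mul1r.
    + by apply: emeasurable_funM => //; exact/measurable_EFinP.
    + by move=> x _; rewrite mule_ge0.
  - by apply: emeasurable_funM => //; exact/measurable_EFinP.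
  - by move=> x; rewrite mule_ge0// lee_fin.
rewrite ge0_integral_normal; last 2 first.
- apply: (@measurable_fun_fubini_tonelli_G _ _ _ _ _ N
    (fun xy : R * R => f (a * xy.1 + b * xy.2)%R)) => //.
  apply: measurableT_comp => //.
  by apply: measurable_funD => //; exact: measurable_funM.
- by move=> y; exact: integral_ge0.
under eq_integral do rewrite inner.
have mfg : measurable_fun setT (fun zy : R * R => f zy.1 * (g zy.1 zy.2)%:E)%E.
  apply: emeasurable_funM; last exact/measurable_EFinP.
  exact: measurableT_comp.
have fg0 zy : (0 <= f zy.1 * (g zy.1 zy.2)%:E)%E by rewrite mule_ge0// lee_fin.
rewrite ge0_integralZl//; last 3 first.
- exact: (@measurable_fun_fubini_tonelli_G _ _ _ _ R mu _ mfg fg0).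
- by move=> y _; apply: integral_ge0 => z _; exact: (fg0 (z, y)).
- by rewrite lee_fin invr_ge0 ltW.
rewrite -(@fubini_tonelli _ _ _ _ R mu mu _ mfg fg0)/=.
have outer z : (\int[mu]_y (f z * (g z y)%:E) =
    f z * (a / r * pdf (z / r))%:E)%E.
  rewrite ge0_integralZl//; last first.
    by move=> y _; rewrite lee_fin.
    by have /measurable_EFinP := mgz z.
  congr (_ * _)%E.
  under eq_integral do rewrite /g pdf_convolution// EFinM.
  rewrite ge0_integralZl//.
  - by rewrite integral_normal_pdf mule1.
  - by apply/measurable_EFinP; exact: measurable_normal_pdf.
  - by move=> y _; rewrite lee_fin normal_pdf_ge0.
  - by rewrite lee_fin mulr_ge0 ?normal_pdf_ge0// divr_ge0 ?ltW.
have mh : measurable_fun setT (fun z => f z * (a / r * pdf (z / r))%:E)%E.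
  apply: emeasurable_funM => //; apply/measurable_EFinP.
  apply: measurable_funM => //; apply: measurableT_comp => //.
  exact: measurable_funM.
have h0 z : (0 <= f z * (a / r * pdf (z / r))%:E)%E.
  by rewrite mule_ge0// lee_fin mulr_ge0 ?normal_pdf_ge0// divr_ge0 ?ltW.
under eq_integral do rewrite outer.
rewrite (@ge0_integral_affine _ r 0)//.
- rewrite gtr0_norm// muleA -EFinM ge0_integral_normal//.
  rewrite -ge0_integralZl//.
  + apply: eq_integral => z _; rewrite addr0 muleCA -EFinM; congr (_ * _%:E)%E.
    rewrite [r * z]mulrC mulfK//.
    by field; rewrite r_neq0.
  + exact: (measurableT_comp mh (measurable_affine r 0)).
  + by rewrite lee_fin mulr_ge0 ?invr_ge0 ?ltW.
  + by apply: measurableT_comp => //; exact: mulrl_measurable.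
Qed.

(** For independent X, Y ~ N(0, s^2), a X + b Y is distributed as
    sqrt(a^2 + b^2) X. Stating it with a multiple of a fixed normal variable,
    not with a normal law of another deviation, covers a = b = 0. *)
Lemma ge0_integral_normal_comb (a b : R) (f : measurableTypeR R -> \bar R) :
  0 <= a -> measurable_fun setT f -> (forall x, 0 <= f x)%E ->
  (\int[N]_y \int[N]_x f (a * x + b * y)%R =
   \int[N]_z f (Num.sqrt (a ^+ 2 + b ^+ 2) * z)%R)%E.
Proof.
rewrite le_eqVlt => /predU1P[<- mf f0|]; last first.
  exact: ge0_integral_normal_comb_gt0.
rewrite expr0n add0r sqrtr_sqr.
transitivity (\int[N]_y f (b * y)%R)%E.
  apply: eq_integral => y _; under eq_integral do rewrite mul0r add0r.
  rewrite integral_cst//; have /= -> := @probability_setT _ _ _ N.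
  by rewrite mule1.
have [b0|b0] := leP 0 b; first by rewrite ger0_norm.
rewrite ltr0_norm//.
rewrite -(@ge0_integral_normal_opp (fun y => f (b * y)%R))//.
  by apply: eq_integral => y _; rewrite mulrN mulNr.
by apply: measurableT_comp => //; exact: measurable_funM.
Qed.

End NormalStability.

(** * First and second moments of a centred normal law *)

Section NormalMoments.
Context {R : realType}.
Local Notation mu := (@lebesgue_measure R).
Variable s : R.
Hypothesis s_gt0 : 0 < s.
Local Notation N := (normal_prob 0 s).
Local Notation pdf := (normal_pdf 0 s).

Let s_neq0 : s != 0. Proof. by rewrite gt_eqF. Qed.

Let derive_pdf (x : R) : is_derive x 1 (fun x => - s ^+ 2 * pdf x) (x * pdf x).
Proof.
rewrite normal_pdfE// /normal_fun.
apply: is_derive_eq.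
rewrite !subr0 scaler0 add0r /GRing.scale/= -[s ^+ 2 *+ 2]mulr_natr.
by field.
Qed.

Let cvg_pdf : - s ^+ 2 * pdf x @[x --> +oo] --> 0.
Proof.
rewrite -[X in _ --> X](mulr0 (- s ^+ 2 * normal_peak s)).
rewrite normal_pdfE//; under eq_fun do rewrite mulrA.
apply: cvgM; first exact: cvg_cst.
apply: (@cvg_trans _ ((@gauss_fun R (x * (s * Num.sqrt 2)^-1)) @[x --> +oo])).
  apply: near_eq_cvg; near=> x; rewrite /gauss_fun /normal_fun/= subr0.
  by rewrite expr_div_n exprMn sqr_sqrtr// mulr_natr mulNr.
apply: (cvg_comp (fun x => x * (s * Num.sqrt 2)^-1) (@gauss_fun R)).
  apply: gt0_cvgMly; last exact: cvg_id.
  by rewrite invr_gt0 mulr_gt0// sqrtr_gt0.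
exact: cvg_gauss_fun.
Unshelve. all: by end_near. Qed.

(** On the half line, x times the density has the primitive -s^2 times the
    density. *)
Lemma ge0_integral_normal_negpart :
  (\int[N]_x (Num.max (- x) 0)%:E = (s / Num.sqrt (2 * pi))%:E)%E.
Proof.
have mmax : measurable_fun setT (fun x : measurableTypeR R => (Num.max x 0)%:E).
  by apply/measurable_EFinP; exact: measurable_maxr.
have max0 (x : R) : (0 <= (Num.max x 0)%:E)%E.
  by rewrite lee_fin le_max lexx orbT.
rewrite (@ge0_integral_normal_opp _ s s_gt0 (fun x => (Num.max x 0)%:E))//.
- rewrite ge0_integral_normal//.
  transitivity (\int[mu]_(x in `[0%R, +oo[) (x * pdf x)%:E)%E.
    rewrite [RHS]integral_mkcond; apply: eq_integral => x _.
    rewrite patchE -EFinM; case: ifPn => [|].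
      by rewrite inE/= in_itv/= andbT => x0; rewrite max_l.
    rewrite notin_setE/= in_itv/= andbT => /negP; rewrite -ltNge => x0.
    by rewrite max_r ?mul0r// ltW.
  rewrite (@ge0_continuous_FTC2y _ _ (fun x => - s ^+ 2 * pdf x) _ 0).
  - rewrite -EFinB sub0r normal_pdfE// /normal_fun subr0 expr0n/= oppr0 mul0r.
    rewrite expR0 mulr1 mulNr opprK /normal_peak -mulrnAr sqrtrM ?sqr_ge0//.
    rewrite sqrtr_sqr gtr0_norm// -mulr_natl; congr EFin.
    by field; rewrite s_neq0 gt_eqF// sqrtr_gt0 mulr_gt0// pi_gt0.
  - by move=> x x0; rewrite mulr_ge0 ?normal_pdf_ge0.
  - apply: continuous_subspaceT => x; apply: cvgM; first exact: cvg_id.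
    exact: continuous_normal_pdf.
  - exact: cvg_pdf.
  - by move=> x _; have [] := derive_pdf x.
  - apply: cvg_at_right_filter; apply: cvgM; first exact: cvg_cst.
    exact: continuous_normal_pdf.
  - by move=> x _; rewrite derive1E; have [_ ->] := derive_pdf x.
Qed.

Lemma sinh_ge_id (y : R) : 0 <= y -> 2 * y <= expR y - expR (- y).
Proof.
rewrite le_eqVlt => /predU1P[<-|y0]; first by rewrite oppr0 subrr mulr0.
pose f (x : R) := expR x - expR (- x).
have df x : is_derive x (1 : R) f (expR x + expR (- x)).
  by apply: is_derive_eq; rewrite /GRing.scale/=; ring.
have [x _ ] : exists2 x, x \in `]0, y[%R &
    f y - f 0 = (expR x + expR (- x)) * (y - 0).
  apply: MVT => //; apply: continuous_subspaceT => x.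
  exact/differentiable_continuous/derivable1_diffP.
rewrite /f oppr0 subrr !subr0 ?addr0 => ->; rewrite ler_pM2r//.
by have := expR_ge1Dx x; have := expR_ge1Dx (- x); lra.
Qed.

(** e^x + e^(-x) - 2 is the square of e^(x/2) - e^(-x/2). *)
Lemma cosh_ge_quadratic (x : R) : x ^+ 2 + 2 <= expR x + expR (- x).
Proof.
wlog x0 : x / 0 <= x.
  move=> H; have [|x0] := leP 0 x; first exact: H.
  by have := H (- x); rewrite sqrrN opprK (addrC (expR (- x))); apply; lra.
have := sinh_ge_id (x / 2); rewrite divr_ge0// => /(_ isT).
rewrite (mulrC 2) divfK// => h.
have : x ^+ 2 <= (expR (x / 2) - expR (- (x / 2))) ^+ 2.
  by rewrite ler_sqr ?nnegrE// (le_trans x0).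
rewrite sqrrB -!expRM_natl -expRD subrr expR0.
have -> : 2%:R * (x / 2) = x by field.
have -> : 2%:R * (- (x / 2)) = - x by field.
lra.
Qed.

Lemma integral_normal_expR (t : R) :
  (\int[N]_x (expR (t * x))%:E = (expR (t ^+ 2 * s ^+ 2 / 2))%:E)%E.
Proof.
rewrite ge0_integral_normal.
- transitivity (\int[mu]_x ((expR (t ^+ 2 * s ^+ 2 / 2))%:E *
    (normal_pdf (t * s ^+ 2) s x)%:E))%E.
    apply: eq_integral => x _; rewrite -!EFinM !normal_pdfE// /normal_fun.
    rewrite !(mulrCA _ (normal_peak s)) -!expRD -[s ^+ 2 *+ 2]mulr_natr.
    by congr (_ * expR _)%:E; field.
  rewrite ge0_integralZl//.
  - by rewrite integral_normal_pdf mule1.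
  - by apply/measurable_EFinP; exact: measurable_normal_pdf.
  - by move=> x _; rewrite lee_fin normal_pdf_ge0.
- apply/measurable_EFinP; apply: measurableT_comp => //.
- by move=> x; rewrite lee_fin expR_ge0.
Qed.

(** The moment generating function is explicit, and
    (t x)^2 <= e^(t x) + e^(-t x) - 2, so t^2 E X^2 <= 2 (e^h - 1) with
    h = t^2 s^2 / 2. Dividing by t^2 and letting h tend to 0 leaves s^2. *)
Lemma integral_normal_sqr_le : (\int[N]_x (x ^+ 2)%:E <= (s ^+ 2)%:E)%E.
Proof.
have bound (h : R) : 0 < h -> (\int[N]_x (x ^+ 2)%:E <= (s ^+ 2 * expR h)%:E)%E.
  move=> h0; set V := (\int[N]_x _)%E.
  (* chosen so that t^2 s^2 / 2 = h *)
  pose t := Num.sqrt (2 * h) / s.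
  have t2 : t ^+ 2 = 2 * h / s ^+ 2.
    by rewrite expr_div_n sqr_sqrtr// mulr_ge0// ltW.
  have mX : measurable_fun setT (fun x : measurableTypeR R => (x ^+ 2)%:E).
    by apply/measurable_EFinP; exact: measurable_funX.
  have mE (c : R) :
      measurable_fun setT (fun x : measurableTypeR R => (expR (c * x))%:E).
    by apply/measurable_EFinP; apply: measurableT_comp => //.
  have X0 (x : measurableTypeR R) : (0 <= (x ^+ 2)%:E)%E.
    by rewrite lee_fin sqr_ge0.
  have T0 : (0 <= (t ^+ 2)%:E)%E by rewrite lee_fin sqr_ge0.
  have : (\int[N]_x ((t ^+ 2)%:E * (x ^+ 2)%:E + 2%:E) <=
          \int[N]_x ((expR (t * x))%:E + (expR (- t * x))%:E))%E.
    apply: ge0_le_integral => //=.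
    - by move=> x _; rewrite adde_ge0// mule_ge0.
    - by apply: emeasurable_funD => //; exact: measurable_funeM.
    - exact: emeasurable_funD.
    - move=> x _; rewrite -EFinM -!EFinD lee_fin -exprMn mulNr.
      exact: cosh_ge_quadratic.
  rewrite ge0_integralD//=; last 2 first.
    by move=> x _; rewrite mule_ge0.
    exact: measurable_funeM.
  rewrite ge0_integralZl// -/V integral_cst//.
  have /= -> := @probability_setT _ _ _ N; rewrite mule1.
  rewrite ge0_integralD//=.
  rewrite !integral_normal_expR sqrrN t2 divfK ?sqrf_eq0//.
  rewrite (mulrC 2) mulfK// -EFinD -leeBrDr// -EFinB => le1.
  have k0 : 0 < h * 2 / s ^+ 2 by rewrite divr_gt0 ?exprn_gt0// mulr_gt0.
  move: le1; rewrite -lee_pdivlMl// => /le_trans; apply.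
  rewrite -EFinM lee_fin ler_pdivrMl// [X in _ <= X](_ : _ =
    2 * h * expR h); last by field; rewrite s_neq0.
  have := expR_ge1Dx (- h); have := expRxMexpNx_1 h; have := expR_gt0 h.
  move=> e0 e1 e2.
  have : expR h * (1 + - h) <= 1 by rewrite -[X in _ <= X]e1 ler_pM2l.
  lra.
apply/lee_addgt0Pr => e e0.
(* the h for which s^2 e^h = s^2 + e *)
have lne : 0 < ln (1 + e / s ^+ 2).
  by rewrite ln_gt0// ltrDl divr_gt0// exprn_gt0.
apply: (le_trans (bound _ lne)).
rewrite lnK ?posrE ?addr_gt0// ?divr_gt0 ?exprn_gt0//.
by rewrite lee_fin mulrDr mulr1 mulrCA mulfV ?sqrf_eq0// mulr1.
Qed.
End NormalMoments.

(** * Image laws and joint laws of independent variables *)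

Section ImageProbability.
Context {d d'} {T : measurableType d} {T' : measurableType d'} {R : realType}.
Variables (P : probability T R) (f : T -> T').
Hypothesis mf : measurable_fun setT f.

Definition image_prob : probability T' R :=
  distribution P (HB.pack_for {mfun T >-> T'} f
    (isMeasurableFun.Build _ _ _ _ _ mf)).

Lemma ge0_integral_image_prob (g : T' -> \bar R) :
  measurable_fun setT g -> (forall y, 0 <= g y)%E ->
  (\int[image_prob]_y g y = \int[P]_x g (f x))%E.
Proof. by move=> mg g0; exact: ge0_integral_distribution. Qed.

End ImageProbability.

Section JointLaw.
Context {d d1 d2} {T : measurableType d} {T1 : measurableType d1}
  {T2 : measurableType d2} {R : realType}.
Variables (mu : {measure set T -> \bar R}) (X : T -> T1) (Y : T -> T2).
Hypotheses (mX : measurable_fun setT X) (mY : measurable_fun setT Y).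
Variables (m1 : {sigma_finite_measure set T1 -> \bar R})
  (m2 : {sigma_finite_measure set T2 -> \bar R}).
Hypothesis muXY : forall A B, measurable A -> measurable B ->
  mu (X @^-1` A `&` Y @^-1` B) = (m1 A * m2 B)%E.

(** Independence in a form that allows mu not to be a probability: with mu the
    restriction of P to an event, m1 absorbs the mass of that event. *)
Lemma ge0_integral_joint (f : T1 * T2 -> \bar R) :
  measurable_fun setT f -> (forall z, 0 <= f z)%E ->
  (\int[mu]_w f (X w, Y w) = \int[m1]_x \int[m2]_y f (x, y))%E.
Proof.
move=> mf f0.
have mXY : measurable_fun setT (fun w => (X w, Y w)).
  exact: measurable_fun_pair.
rewrite -[RHS](@fubini_tonelli1 _ _ _ _ _ m1 m2 f mf f0).
pose push := @measure_function_pushforward__canonical__measure_function_Measure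
  _ _ _ _ R mu _ mXY.
rewrite (eq_measure_integral push); last first.
  move=> A mA _; apply: product_measure_unique => // B C mB mC.
by rewrite [RHS]ge0_integral_pushforward.
Qed.

End JointLaw.

Lemma measurable_sumR {d} {T : measurableType d} {R : realType} {I : Type}
    (l : seq I) (Q : pred I) (h : I -> T -> R) :
  (forall i, measurable_fun setT (h i)) ->
  measurable_fun setT (fun x => \sum_(i <- l | Q i) h i x).
Proof.
move=> mh; elim: l => [|i l IH].
  by under eq_fun do rewrite big_nil; exact: measurable_cst.
under eq_fun do rewrite big_cons; case: (Q i) => //.
exact: measurable_funD.
Qed.

Lemma integral_cst_prob {d} {T : measurableType d} {R : realType}
    (P : probability T R) (c : R) : (\int[P]_w c%:E = c%:E)%E.
Proof.
rewrite integral_cst//; have /= -> := @probability_setT _ _ _ P.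
by rewrite mule1.
Qed.

(** * Borel sets of row vectors *)

(** Row vectors with the Borel sigma-algebra: its measurable sets are by
    definition those of [borel]. *)
Notation borelV R p := (g_sigma_algebraType [set U : set 'rV[R]_p | open U]).

Section RowBorel.
Context {R : realType} {p : nat}.

Lemma continuous_measurable_row (f : 'rV[R]_p -> R) : continuous f ->
  measurable_fun setT (f : borelV R p -> R).
Proof.
move=> /continuousP cf; apply: (measurability _ (RGenOpens.measurableE R)).
move=> _ [_ [a [b ->]] <-]; rewrite setTI.
by apply: sub_sigma_algebra; apply: cf; exact: interval_open.
Qed.

(** An open set is the countable union of the boxes with rational centre and
    radius 1/(n+1) that it contains. *)
Lemma measurable_row {d} {T : measurableType d} (f : T -> 'rV[R]_p) :
  (forall i, measurable_fun setT (fun w => f w 0 i)) ->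
  measurable_fun setT (f : T -> borelV R p).
Proof.
move=> mf; apply: (@measurability _ _ T (borelV R p) setT f
  [set U : set (borelV R p) | open (U : set 'rV[R]_p)]) => //.
move=> _ [U oU <-]; rewrite setTI.
pose box (q : 'rV[rat]_p * nat) : set 'rV[R]_p :=
  [set x | forall i, `|x 0 i - ratr (q.1 0 i)| < q.2.+1%:R^-1].
have -> : U = \bigcup_q (if `[< box q `<=` U >] then box q else set0).
  apply/seteqP; split=> [x Ux|x [q _]]; last first.
    by case: asboolP => [qU /qU|_ []].
  have /nbhs_ballP[e /= e0 xeU] := oU x Ux.
  (* a box of radius 1/(n+1) around x must fit in the ball of radius e even
     after its centre is moved to a rational point *)
  pose n := Num.truncn (2 / e).
  have ne : 2 * n.+1%:R^-1 < e.
    by rewrite ltr_pdivrMr// mulrC -ltr_pdivrMr// truncnS_gt.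
  have hq (i : 'I_p) : exists r : rat, `|x 0 i - ratr r| < n.+1%:R^-1 :> R.
    have n0 : 0 < n.+1%:R^-1 :> R by rewrite invr_gt0.
    have : x 0 i < x 0 i + n.+1%:R^-1 by rewrite ltrDl.
    move=> /rat_in_itvoo[r]; rewrite in_itv/= => /andP[xr rx].
    by exists r; rewrite distrC gtr0_norm ?subr_gt0// ltrBlDl.
  pose q := \row_i xchoose (hq i).
  have xq : box (q, n) x by move=> i /=; rewrite mxE; exact: (xchooseP (hq i)).
  exists (q, n) => //; case: asboolP => // -[] y yq.
  apply: xeU; split => // i j; rewrite (ord1 i).
  have := yq j; have := xq j; move=> /= xj yj.
  rewrite /ball/= (le_lt_trans (ler_distD (ratr (q 0 j)) _ _))//.
  rewrite (lt_trans _ ne)// mulr_natl mulr2n ltrD//.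
  by rewrite distrC.
rewrite preimage_bigcup; apply: countable_bigcupT_measurable => // q.
case: asboolP => _; last by rewrite preimage_set0.
have -> : f @^-1` box q = \bigcap_i
    ((fun w => `|f w 0 i - ratr (q.1 0 i)|) @^-1` `]-oo, q.2.+1%:R^-1[).
  by apply/seteqP; split=> [w fw i _|w fw i]; have := fw i;
    rewrite /= in_itv/= => // /(_ I).
apply: fin_bigcap_measurable => // i _; rewrite -[X in measurable X]setTI.
have : measurable_fun setT (fun w => `|f w 0 i - ratr (q.1 0 i)|).
  by apply: measurableT_comp => //; exact: measurable_funB.
by apply => //; exact: measurable_itv.
Qed.

End RowBorel.

(** * Linear forms of an isotropic Gaussian vector *)

Definition dot {R : realType} {p : nat} (a x : 'rV[R]_p) : R :=
  \sum_(i < p) a 0 i * x 0 i.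

Section GaussianVector.
Context {R : realType} {p : nat} {d : measure_display}
  {Omega : measurableType d}.
Variables (P : probability Omega R) (s2 : R) (X : Omega -> 'rV[R]_p).
Hypotheses (s2_gt0 : 0 < s2) (gX : isotropic_gaussian P s2 X).
Let s := Num.sqrt s2.
Let s_gt0 : 0 < s. Proof. by rewrite sqrtr_gt0. Qed.
Local Notation N := (normal_prob 0 s).

Lemma measurable_gaussian : measurable_fun setT (X : Omega -> borelV R p).
Proof. by move=> _ B mB; rewrite setTI; exact: gX.1. Qed.

Lemma measurable_gaussian_coord i : measurable_fun setT (fun w => X w 0 i).
Proof.
have mc := continuous_measurable_row _ (@coord_continuous R 1 p 0 i).
exact: (measurableT_comp mc measurable_gaussian).
Qed.
Let mX := measurable_gaussian_coord.

Variable a : 'rV[R]_p.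

Let S k w := \sum_(i < p | (i < k)%N) a 0 i * X w 0 i.
Let r k := Num.sqrt (\sum_(i < p | (i < k)%N) a 0 i ^+ 2).

Let mS k : measurable_fun setT (S k).
Proof.
by apply: measurable_sumR => i; exact: measurable_funM.
Qed.

Let tail k (A : 'I_p -> set R) : set Omega :=
  [set w | forall i : 'I_p, (k <= i)%N -> A i (X w 0 i)].

Let mtail k A : (forall i, measurable (A i)) -> measurable (tail k A).
Proof.
move=> mA; rewrite (_ : tail k A = \bigcap_(i in [set i : 'I_p | (k <= i)%N])
    ((fun w => X w 0 i) @^-1` A i)); last first.
  by apply/seteqP; split=> w h i; exact: h.
apply: fin_bigcap_measurable => // i _; rewrite -[X in measurable X]setTI.
exact: mX.
Qed.

Let N_ge0 A : (0 <= N A)%E. Proof. exact: measure_ge0. Qed.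

(** Coordinates are absorbed into the linear form one at a time. Keeping the
    events on the coordinates not yet used inside the statement is what lets
    the product formula for boxes supply the independence needed at the next
    step. *)
Let partial_law k : (k <= p)%N -> forall B A, measurable B ->
  (forall i, measurable (A i)) ->
  P (S k @^-1` B `&` tail k A) =
  (N ((fun z : R => r k * z)%R @^-1` B) * \prod_(i < p | (k <= i)%N) N (A i))%E.
Proof.
elim: k => [_ B A mB mA|k IH kp B A mB mA].
  have S0 w : S 0 w = 0 by apply: big_pred0 => i.
  have r0 : r 0 = 0 by rewrite /r big_pred0 ?sqrtr0.
  have [B0|nB0] := pselect (B 0).
    rewrite (_ : S 0 @^-1` B = setT); last first.
      by apply/seteqP; split => // w _; rewrite /= S0.
    rewrite (_ : _ @^-1` B = setT); last first.
      by apply/seteqP; split => // w _ /=; rewrite r0 mul0r.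
    have /= -> := @probability_setT _ _ _ N; rewrite mul1e setTI.
    rewrite -gX.2//; congr (P _).
    by apply/seteqP; split=> w h i; [exact: h|move=> _; exact: h].
  rewrite (_ : S 0 @^-1` B = set0); last first.
    by apply/seteqP; split => // w; rewrite /= S0.
  rewrite (_ : _ @^-1` B = set0); last first.
    by apply/seteqP; split => // w /=; rewrite r0 mul0r.
  by rewrite set0I !measure0 mul0e.
pose i0 := Ordinal kp.
have Sk w : S k.+1 w = S k w + a 0 i0 * X w 0 i0.
  rewrite /S (bigD1 i0)//= addrC; congr (_ + _); apply: eq_bigl => i.
  by rewrite ltnS -val_eqE/= andbC -ltn_neqAle.
have rk : r k.+1 = Num.sqrt (r k ^+ 2 + a 0 i0 ^+ 2).
  rewrite sqr_sqrtr ?sumr_ge0// => [|i _]; last by rewrite sqr_ge0.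
  rewrite /r (bigD1 i0)//= addrC; congr (Num.sqrt (_ + _)); apply: eq_bigl => i.
  by rewrite ltnS -val_eqE/= andbC -ltn_neqAle.
have rk0 : 0 <= r k by rewrite sqrtr_ge0.
pose c := fine (\prod_(i < p | (k.+1 <= i)%N) N (A i))%E.
have cE : (\prod_(i < p | (k.+1 <= i)%N) N (A i) = c%:E)%E.
  rewrite fineK//; apply: prode_fin_num => i _.
  by apply: (@fin_num_measure _ _ R N); exact: mA.
have c0 : 0 <= c.
  by apply: fine_ge0; apply: prode_ge0 => i _; exact: N_ge0.
(* on the event [tail k.+1 A] the pair (S k, X_k) has a product law *)
pose mu := mrestr P (mtail k.+1 A mA).
have mrk : measurable_fun setT
    (fun z : measurableTypeR R => r k * z : measurableTypeR R).
  exact: mulrl_measurable.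
pose m1 := mscale (NngNum c0) (image_prob N _ mrk).
have joint B1 B2 : measurable B1 -> measurable B2 ->
    mu (S k @^-1` B1 `&` (fun w => X w 0 i0) @^-1` B2) = (m1 B1 * N B2)%E.
  move=> mB1 mB2.
  pose A' i := if i == i0 then B2 else A i.
  have mA' i : measurable (A' i) by rewrite /A'; case: ifP.
  have := IH (ltnW kp) B1 A' mB1 mA'.
  rewrite (bigD1 i0)//= {2}/A' eqxx.
  rewrite (_ : (\prod_(i < p | _) _)%E = c%:E); last first.
    rewrite -cE; apply: eq_big => i.
      by rewrite [RHS]ltn_neqAle andbC eq_sym.
    by rewrite /A' => /andP[_ /negbTE ->].
  rewrite [(N B2 * _)%E]muleC muleA [(_ * c%:E)%E]muleC.
  move=> <-; rewrite /mu /mrestr -setIA; congr (P (_ `&` _)).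
  apply/seteqP; split=> [w [Bw Aw] i ki|w Aw].
    rewrite /A'; case: eqVneq => [->//|ii0]; apply: Aw.
    by rewrite ltn_neqAle ki andbT eq_sym.
  split=> [|i ki]; first by have := Aw i0 (leqnn _); rewrite /A' eqxx.
  have := Aw i (ltnW ki); rewrite /A'; case: eqVneq => // ii0.
  by move: ki; rewrite ii0/= ltnn.
have mB' : measurable_fun setT
    (fun z : measurableTypeR R * measurableTypeR R =>
       (\1_B (z.1 + a 0 i0 * z.2))%:E : \bar R).
  apply/measurable_EFinP; apply: measurableT_comp => //.
  apply: measurable_funD => //; exact: measurable_funM.
have e := @ge0_integral_joint _ _ _ Omega
  (measurableTypeR R) (measurableTypeR R) R mu _ _
  (mS k) (mX i0) m1 N joint _ mB'.
have B0 x : (0 <= (\1_B x)%:E :> \bar R)%E by rewrite lee_fin.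
have mBk : measurable (S k.+1 @^-1` B).
  by rewrite -[X in measurable X]setTI; exact: mS.
transitivity (\int[mu]_w (\1_B (S k w + a 0 i0 * X w 0 i0))%:E)%E.
  transitivity (\int[mu]_w (\1_(S k.+1 @^-1` B) w)%:E)%E.
    by rewrite integral_indic// setIT.
  by apply: eq_integral => w _; rewrite -Sk.
rewrite {}e; last by move=> z; exact: B0.
rewrite ge0_integral_mscale//=; last 2 first.
- exact: (@measurable_fun_fubini_tonelli_F _ _ _ _ R N _ mB').
- by move=> x _; apply: integral_ge0.
rewrite ge0_integral_image_prob; last 2 first.
- exact: (@measurable_fun_fubini_tonelli_F _ _ _ _ R N _ mB').
- by move=> x; apply: integral_ge0.
rewrite cE muleC; congr (_ * _)%E.
have mrB : measurable_fun setT (fun z : measurableTypeR R * measurableTypeR R =>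
    (\1_B (r k * z.1 + a 0 i0 * z.2))%:E : \bar R).
  apply/measurable_EFinP; apply: measurableT_comp => //.
  by apply: measurable_funD => //; exact: measurable_funM.
rewrite (@fubini_tonelli _ _ _ _ R N N _ mrB)/=; last by move=> z; exact: B0.
rewrite (ge0_integral_normal_comb s s_gt0 (r k) (a 0 i0)
  (fun z => (\1_B z)%:E) rk0)//.
- rewrite -rk.
  transitivity (\int[N]_z (\1_((fun z => r k.+1 * z) @^-1` B) z)%:E)%E => //.
  have mr : measurable_fun setT
      (fun z : measurableTypeR R => r k.+1 * z : measurableTypeR R).
    exact: mulrl_measurable.
  rewrite integral_indic ?setIT// -[X in measurable X]setTI.
  exact: mr.
- exact/measurable_EFinP.
Qed.

(** A linear form of an isotropic Gaussian vector is distributed as [enorm a]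
    times one of its coordinates. *)
Lemma ge0_integral_gaussian_dot (f : R -> \bar R) :
  measurable_fun setT f -> (forall x, 0 <= f x)%E ->
  (\int[P]_w f (dot a (X w)) = \int[N]_z f (enorm a * z)%R)%E.
Proof.
move=> mf f0.
have full (Q : pred 'I_p) (F : 'I_p -> R) : (forall i, Q i) ->
    \sum_(i < p | Q i) F i = \sum_(i < p) F i by move=> h; apply: eq_bigl.
have Sp w : S p w = dot a (X w) by apply: full.
have rp : r p = enorm a by congr Num.sqrt; apply: full.
have mr : measurable_fun setT
    (fun z : measurableTypeR R => enorm a * z : measurableTypeR R).
  exact: mulrl_measurable.
rewrite -(ge0_integral_image_prob _ _ mr f mf f0).
have mSp : measurable_fun setT (S p : Omega -> measurableTypeR R) by exact: mS.
rewrite [RHS](eq_measure_integral (image_prob P _ mSp)).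
  rewrite [RHS]ge0_integral_image_prob//.
  by apply: eq_integral => w _; rewrite Sp.
move=> A mA _.
have := partial_law p (leqnn p) A (fun=> setT) mA (fun=> measurableT).
rewrite big_pred0; last by move=> i; rewrite leqNgt ltn_ord.
rewrite mule1 (_ : tail p _ = setT); last by apply/seteqP; split.
by rewrite setIT rp => e; exact/esym/e.
Qed.

Lemma integral_gaussian_dot_negpart :
  (\int[P]_w (Num.max (- dot a (X w)) 0)%:E =
    (enorm a * (s / Num.sqrt (2 * pi)))%:E)%E.
Proof.
have mm : measurable_fun setT (fun x : R => (Num.max (- x) 0)%:E).
  by apply/measurable_EFinP; apply: measurable_maxr.
have m0 (x : R) : (0 <= (Num.max (- x) 0)%:E)%E.
  by rewrite lee_fin le_max lexx orbT.
rewrite (ge0_integral_gaussian_dot (fun x => (Num.max (- x) 0)%:E))//.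
under eq_integral do rewrite -mulrN -[X in Num.max _ X](mulr0 (enorm a))
  -maxr_pMr ?sqrtr_ge0// EFinM.
by rewrite ge0_integralZl ?lee_fin ?sqrtr_ge0// ge0_integral_normal_negpart.
Qed.
End GaussianVector.

(** * Symmetry of an isotropic Gaussian vector *)

Definition sqnorm {R : realType} {p : nat} (x : 'rV[R]_p) : R :=
  \sum_(i < p) x 0 i ^+ 2.

(** The hypothesis prescribes the law on boxes; these are stable under
    intersection and generate the Borel sets. *)
Lemma isotropic_gaussian_law {R : realType} {p : nat} {d d'}
    {Omega : measurableType d} {Omega' : measurableType d'}
    (P : probability Omega R) (P' : probability Omega' R) (s2 : R)
    (X : Omega -> 'rV[R]_p) (Y : Omega' -> 'rV[R]_p) :
  isotropic_gaussian P s2 X -> isotropic_gaussian P' s2 Y ->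
  forall B, borel B -> P (X @^-1` B) = P' (Y @^-1` B).
Proof.
move=> gX gY B mB.
pose G : set (set (borelV R p)) := [set C |
  exists2 A : 'I_p -> set R, (forall i, measurable (A i)) &
    C = [set x : 'rV[R]_p | forall i, A i (x 0 i)]].
pose PX := image_prob P (X : Omega -> borelV R p)
  (measurable_gaussian _ _ _ gX).
pose PY := image_prob P' (Y : Omega' -> borelV R p)
  (measurable_gaussian _ _ _ gY).
suff : PX B = PY B by [].
have borelG : <<s G >> B.
  have : measurable_fun (T := g_sigma_algebraType G) setT
      (id : g_sigma_algebraType G -> borelV R p).
    apply: measurable_row => i _ A mA; rewrite setTI.
    apply: sub_sigma_algebra.
    exists (fun j => if j == i then A else setT).
      by move=> j; case: ifP.
    apply/seteqP; split=> [x xA j|x /(_ i)]; last by rewrite eqxx.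
    by case: eqVneq => // ->.
  by move=> /(_ measurableT B mB); rewrite setTI.
have Gm : G `<=` measurable.
  move=> _ [A mA ->].
  rewrite (_ : [set x | _] =
      \bigcap_i ((fun x : 'rV[R]_p => x 0 i) @^-1` A i)).
    apply: fin_bigcap_measurable => // i _; rewrite -[X in measurable X]setTI.
    by apply: (continuous_measurable_row _ (@coord_continuous R 1 p 0 i)).
  by apply/seteqP; split=> x xA i; [move=> _|]; exact: xA.
have GT : G setT by exists (fun=> setT) => //; apply/seteqP; split.
apply: (g_sigma_algebra_measure_unique _ Gm (fun=> setT) (fun=> GT)) => //.
- by rewrite bigcup_const//; exists 0%N.
- move=> _ _ [A mA ->] [A' mA' ->].
  exists (fun i => A i `&` A' i); first by move=> i; exact: measurableI.
  apply/seteqP; split=> x; first by case=> h h' i; split.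
  by move=> h; split=> i; case: (h i).
- by move=> _ [A mA ->]; exact: etrans (gX.2 A mA) (esym (gY.2 A mA)).
- by move=> _; rewrite (le_lt_trans (probability_le1 _ _))// ltry.
Qed.

Section GaussianVectorSymmetry.
Context {R : realType} {p : nat} {d : measure_display}
  {Omega : measurableType d}.
Variables (P : probability Omega R) (s2 : R) (X : Omega -> 'rV[R]_p).
Hypotheses (s2_gt0 : 0 < s2) (gX : isotropic_gaussian P s2 X).
Let s := Num.sqrt s2.
Let s_gt0 : 0 < s. Proof. by rewrite sqrtr_gt0. Qed.
Local Notation N := (normal_prob 0 s).

Lemma isotropic_gaussian_opp : isotropic_gaussian P s2 (fun w => - X w).
Proof.
have mNX : measurable_fun setT ((fun w => - X w) : Omega -> borelV R p).
  apply: measurable_row => i; under eq_fun do rewrite mxE.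
  by apply: measurableT_comp => //; exact: (measurable_gaussian_coord _ _ _ gX).
split=> [B mB|A mA]; first by rewrite -[X in measurable X]setTI; exact: mNX.
pose A' i := -%R @^-1` A i.
have mA' i : measurable (A' i).
  by rewrite -[X in measurable X]setTI; exact: oppr_measurable.
rewrite -[LHS]/(P _) (_ : [set w | _] = [set w | forall i, A' i (X w 0 i)]).
  rewrite gX.2//; apply: eq_bigr => i _.
  have NE C : measurable C -> (N C = \int[N]_x (\1_C x)%:E)%E.
    by move=> mC; rewrite integral_indic// setIT.
  apply: etrans (NE _ (mA' i)) (etrans _ (esym (NE _ (mA i)))).
  apply: (ge0_integral_normal_opp s s_gt0 (fun x => (\1_(A i) x)%:E)) => //.
  by apply/measurable_EFinP; apply: measurable_indic; exact: mA.
by apply/seteqP; split=> w h i; have := h i; rewrite /A' /= mxE.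
Qed.

Lemma ge0_integral_gaussian_opp (F : borelV R p -> \bar R) :
  measurable_fun setT F -> (forall x, 0 <= F x)%E ->
  (\int[P]_w F (- X w)%R = \int[P]_w F (X w))%E.
Proof.
move=> mF F0.
have mX := measurable_gaussian _ _ _ gX.
have mNX := measurable_gaussian _ _ _ isotropic_gaussian_opp.
rewrite -(ge0_integral_image_prob _ _ mX)//.
rewrite -(ge0_integral_image_prob _ _ mNX)//.
apply: eq_measure_integral => A mA _.
exact: isotropic_gaussian_law isotropic_gaussian_opp gX _ mA.
Qed.

Lemma integral_gaussian_sqnorm_le :
  (\int[P]_w (sqnorm (X w))%:E <= (p%:R * s2)%:E)%E.
Proof.
under eq_integral do rewrite -sumEFin.
rewrite ge0_integral_sum//; last 2 first.
- move=> i; apply/measurable_EFinP; apply: measurable_funX.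
  exact: (measurable_gaussian_coord _ _ _ gX).
- by move=> i w _; rewrite lee_fin sqr_ge0.
apply: (@le_trans _ _ (\sum_(i < p) s2%:E)%E); last first.
  by rewrite sumEFin sumr_const card_ord mulr_natl.
apply: lee_sum => i _.
have -> : s2 = s ^+ 2 by rewrite sqr_sqrtr// ltW.
have dot_delta w : dot (delta_mx 0 i) (X w) = X w 0 i.
  rewrite /dot (bigD1 i)//= big1 ?addr0 => [|j /negbTE ji]; rewrite mxE eqxx.
    by rewrite eqxx mul1r.
  by rewrite ji mul0r.
have enorm_delta : enorm (delta_mx 0 i : 'rV[R]_p) = 1.
  rewrite /enorm (bigD1 i)//= big1 ?addr0 => [|j /negbTE ji]; rewrite mxE eqxx.
    by rewrite eqxx expr1n sqrtr1.
  by rewrite ji expr0n.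
under eq_integral do rewrite -dot_delta.
rewrite (ge0_integral_gaussian_dot P s2 X s2_gt0 gX _ (fun x => (x ^+ 2)%:E)).
- under eq_integral do rewrite enorm_delta mul1r.
  exact: integral_normal_sqr_le.
- by apply/measurable_EFinP; exact: measurable_funX.
- by move=> x; rewrite lee_fin sqr_ge0.
Qed.

(** By symmetry the integrals over the half spaces dot a x < 0 and dot a x > 0
    are equal, and together they are at most the full second moment. When
    a = 0 both are empty. *)
Lemma integral_gaussian_halfspace_sqnorm_le (a : 'rV[R]_p) :
  (\int[P]_w (if dot a (X w) < 0 then sqnorm (X w) else 0)%:E
    <= (p%:R * s2 / 2)%:E)%E.
Proof.
pose F (x : borelV R p) : \bar R := (if dot a x < 0 then sqnorm x else 0)%:E.
have mc i : measurable_fun setT (fun x : borelV R p => (x : 'rV[R]_p) 0 i).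
  exact: (continuous_measurable_row _ (@coord_continuous R 1 p 0 i)).
have F0 x : (0 <= F x)%E.
  rewrite lee_fin; case: ifP => // _; rewrite sumr_ge0// => i _.
  by rewrite sqr_ge0.
have mF : measurable_fun setT F.
  apply/measurable_EFinP; apply: measurable_fun_ifT => //.
  - apply: measurable_fun_ltr => //.
    by apply: measurable_sumR => i; exact: measurable_funM.
  - by apply: measurable_sumR => i; exact: measurable_funX.
have mX := measurable_gaussian _ _ _ gX.
have mNX := measurable_gaussian _ _ _ isotropic_gaussian_opp.
have half : (\int[P]_w F (X w) + \int[P]_w F (X w) <= (p%:R * s2)%:E)%E.
  rewrite -[X in (X + _)%E](ge0_integral_gaussian_opp _ mF F0).
  rewrite -ge0_integralD//; last 2 first.
    exact: (measurableT_comp mF mNX).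
    exact: (measurableT_comp mF mX).
  apply: (le_trans _ integral_gaussian_sqnorm_le).
  apply: ge0_le_integral => //.
  - by move=> w _; rewrite adde_ge0.
  - apply: emeasurable_funD.
      exact: (measurableT_comp mF mNX).
    exact: (measurableT_comp mF mX).
  - apply/measurable_EFinP; apply: measurable_sumR => i.
    apply: measurable_funX; exact: (measurable_gaussian_coord _ _ _ gX).
  - move=> w _; rewrite /F -EFinD lee_fin.
    have -> : dot a (- X w) = - dot a (X w).
      by rewrite /dot -sumrN; apply: eq_bigr => i _; rewrite mxE mulrN.
    have -> : sqnorm (- X w) = sqnorm (X w).
      by apply: eq_bigr => i _; rewrite mxE sqrrN.
    have q0 : 0 <= sqnorm (X w) by rewrite sumr_ge0// => i _; rewrite sqr_ge0.
    rewrite oppr_lt0; case: ltgtP => _; lra.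
rewrite -/(F _) mulrC EFinM lee_pdivlMl// mule_natl.
by rewrite mule2n.
Qed.

End GaussianVectorSymmetry.

(** * Functions with Lipschitz gradient *)

Section Euclid.
Context {R : realType} {p : nat}.
Implicit Types (a b u w : 'rV[R]_p) (f : 'rV[R]_p -> R).

Lemma sqnorm_ge0 u : 0 <= sqnorm u.
Proof. by apply: sumr_ge0 => i _; rewrite sqr_ge0. Qed.

Lemma enorm_ge0 u : 0 <= enorm u. Proof. exact: sqrtr_ge0. Qed.

Lemma sqr_enorm u : enorm u ^+ 2 = sqnorm u.
Proof. by rewrite sqr_sqrtr// sqnorm_ge0. Qed.

Lemma enormZ (c : R) u : enorm (c *: u) = `|c| * enorm u.
Proof.
rewrite -sqrtr_sqr -sqrtrM ?sqr_ge0//; congr Num.sqrt.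
by rewrite mulr_sumr; apply: eq_bigr => i _; rewrite mxE exprMn.
Qed.

Lemma dotBl a b w : dot (a - b) w = dot a w - dot b w.
Proof.
by rewrite /dot -sumrB; apply: eq_bigr => i _; rewrite !mxE mulrBl.
Qed.

Lemma dotZr (c : R) a w : dot a (c *: w) = c * dot a w.
Proof.
by rewrite /dot mulr_sumr; apply: eq_bigr => i _; rewrite mxE mulrCA.
Qed.

Lemma sqnormZ (c : R) w : sqnorm (c *: w) = c ^+ 2 * sqnorm w.
Proof.
by rewrite /sqnorm mulr_sumr; apply: eq_bigr => i _; rewrite mxE exprMn.
Qed.

(** Expand the square of |a| b - |b| a. *)
Lemma Cauchy_Schwarz_dot a b : dot a b <= enorm a * enorm b.
Proof.
have [na0|na0] := eqVneq (enorm a) 0.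
  rewrite na0 mul0r.
  have /eqP : sqnorm a = 0 by rewrite -sqr_enorm na0 expr0n.
  rewrite psumr_eq0 => [/allP a0|i _]; last by rewrite sqr_ge0.
  rewrite /dot big1// => i _; have := a0 i (mem_index_enum _).
  by rewrite sqrf_eq0 => /eqP ->; rewrite mul0r.
have a0 : 0 < enorm a by rewrite lt_neqAle eq_sym na0 enorm_ge0.
have h : 0 <= \sum_(i < p) (enorm a * b 0 i - enorm b * a 0 i) ^+ 2.
  by apply: sumr_ge0 => i _; rewrite sqr_ge0.
have : 0 <= enorm a ^+ 2 * sqnorm b - 2 * (enorm a * enorm b) * dot a b
            + enorm b ^+ 2 * sqnorm a.
  apply: (le_trans h); rewrite /sqnorm /dot !mulr_sumr -sumrB -big_split/=.
  by rewrite le_eqVlt; apply/orP; left; apply/eqP; apply: eq_bigr => i _; ring.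
rewrite -!sqr_enorm => {}h.
have [b0|b0] := ltP 0 (enorm b).
  rewrite -(ler_pM2l (mulr_gt0 a0 b0)) -subr_ge0; nra.
have /eqP nb0 : enorm b == 0 by rewrite eq_le b0 enorm_ge0.
have /eqP : sqnorm b = 0 by rewrite -sqr_enorm nb0 expr0n.
rewrite psumr_eq0 => [/allP b00|i _]; last by rewrite sqr_ge0.
rewrite nb0 mulr0 /dot big1// => i _; have := b00 i (mem_index_enum _).
by rewrite sqrf_eq0 => /eqP ->; rewrite mulr0.
Qed.

Lemma derive_dot_grad f u w : differentiable f u -> 'D_w f u = dot (grad f u) w.
Proof.
move=> df; rewrite deriveE// {1}(row_sum_delta w) linear_sum.
apply: eq_bigr => i _; rewrite linearZ/= mxE deriveE//.
by rewrite mulrC.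
Qed.

Variables (L : R) (f : 'rV[R]_p -> R).
Hypothesis fL : smooth L f.

Lemma smooth_continuous : continuous f.
Proof. by move=> u; apply: differentiable_continuous; exact: fL.1. Qed.

Lemma enorm_le_norm u : enorm u <= Num.sqrt p%:R * `|u|.
Proof.
rewrite -[`|u|]ger0_norm// -sqrtr_sqr -sqrtrM// ler_wsqrtr//.
apply: (@le_trans _ _ (\sum_(i < p) `|u| ^+ 2)).
  apply: ler_sum => i _; rewrite -real_normK ?num_real// lerXn2r ?nnegrE//.
  rewrite [X in _ <= X]mx_normrE.
  exact: (le_bigmax _ (fun ij : 'I_1 * 'I_p => `|u ij.1 ij.2|) (0, i)).
by rewrite sumr_const card_ord mulr_natl.
Qed.

Lemma smooth_grad_continuous i : continuous (fun u => grad f u 0 i).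
Proof.
move=> u; apply/(@cvgrPdist_le _ _ _ _ (nbhs_filter u)) => e e0.
pose K := `|L| * Num.sqrt p%:R + 1.
have K0 : 0 < K by rewrite ltr_wpDl// mulr_ge0// sqrtr_ge0.
apply/nbhs_ballP; exists (e / K) => [/=|u']; first by rewrite divr_gt0.
rewrite -ball_normE/= => uu'.
have : `|(grad f u - grad f u') 0 i| <= enorm (grad f u - grad f u').
  rewrite -sqrtr_sqr ler_wsqrtr// (bigD1 i)//= lerDl.
  by apply: sumr_ge0 => j _; rewrite sqr_ge0.
rewrite !mxE => /le_trans; apply; apply: (le_trans (fL.2 _ _)).
apply: (@le_trans _ _ (`|L| * enorm (u - u'))).
  by rewrite ler_wpM2r ?enorm_ge0// ler_norm.
apply: (@le_trans _ _ (K * `|u - u'|)).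
  rewrite mulrDl mul1r (@le_trans _ _ (`|L| * Num.sqrt p%:R * `|u - u'|))//.
    by rewrite -mulrA ler_wpM2l// enorm_le_norm.
  by rewrite lerDl.
by rewrite mulrC -ler_pdivlMr// ltW.
Qed.

Let is_derive_line u w (t : R) :
  is_derive t 1 (fun t => f (u + t *: w)) (dot (grad f (u + t *: w)) w).
Proof.
pose g (t : R^o) := u + t *: w.
have dg : is_diff t g ( *:%R ^~ w).
  rewrite /g; apply: is_diff_eq.
  by apply/funext => x; rewrite /= add0r.
have df := fL.1 (g t).
have dfg : differentiable (f \o g) t by exact: differentiable_comp.
split; first exact/derivable1_diffP.
rewrite -derive_dot_grad// !deriveE// diff_comp//=.
by rewrite diff_val scale1r.
Qed.

(** Along the segment the derivative of the left-hand side exceeds that of the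
    right-hand side by <grad f(u + t w) - grad f(u), w> - L t |w|^2, which is
    nonpositive by Cauchy-Schwarz and the Lipschitz condition. *)
Lemma smooth_descent u w :
  f (u + w) <= f u + dot (grad f u) w + L / 2 * sqnorm w.
Proof.
pose h (t : R) :=
  f (u + t *: w) - t * dot (grad f u) w - L / 2 * sqnorm w * t ^+ 2.
pose dh (t : R) :=
  dot (grad f (u + t *: w)) w - dot (grad f u) w - L * t * sqnorm w.
have hdh (t : R) : is_derive t 1 h (dh t).
  have hl := is_derive_line u w t; rewrite /h.
  apply: is_derive_eq; rewrite /dh /GRing.scale/=.
  by field.
have [c] : exists2 c, c \in `]0, 1[%R & h 1 - h 0 = dh c * (1 - 0).
  apply: MVT => //.
  apply: continuous_subspaceT => x.
  apply/differentiable_continuous/derivable1_diffP.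
  by have [] := hdh x.
rewrite in_itv/= => /andP[c0 _]; rewrite subr0 mulr1 => e.
have : dh c <= 0.
  rewrite /dh -dotBl subr_le0 (le_trans (Cauchy_Schwarz_dot _ _))//.
  rewrite -sqr_enorm expr2 mulrA ler_wpM2r ?enorm_ge0//.
  rewrite (le_trans (fL.2 _ _))// addrAC subrr add0r enormZ gtr0_norm//.
  by rewrite mulrA.
rewrite -e /h scale1r scale0r addr0; lra.
Qed.
End Euclid.

(** * One round of the search, pathwise *)

Section Pathwise.
Context {R : realType} {p : nat}.

Lemma le_supdist (f g : 'rV[R]_p -> R) u :
  has_ubound (gaps f g) -> `|f u - g u| <= supdist f g.
Proof. by move=> ub; apply: ub_le_sup => //; exists u. Qed.

Lemma supdist_ge0 (f g : 'rV[R]_p -> R) :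
  has_ubound (gaps f g) -> 0 <= supdist f g.
Proof. by move=> /(le_supdist f g 0); exact: le_trans. Qed.

(** The new point, measured by f2, is worth at most
    min(tf0 x, tf1 y) + d0 + d1 + b0 + b1, whichever branch is taken, and the
    minimum is at most f0 x + b0 and at most f0 y + d0 + b1. The second bound
    is combined with the descent inequality when v points downhill, the first
    one is used otherwise. *)
Lemma direct_search_step (L delta d0 d1 b0 b1 : R)
    (f0 f1 f2 tf0 tf1 : 'rV[R]_p -> R) (x v : 'rV[R]_p) :
  smooth L f0 -> 0 <= d0 -> 0 <= d1 -> 0 <= b0 -> 0 <= b1 ->
  (forall y, `|f1 y - f0 y| <= d0) -> (forall y, `|f2 y - f1 y| <= d1) ->
  (forall y, `|tf0 y - f0 y| <= b0) -> (forall y, `|tf1 y - f1 y| <= b1) ->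
  let y := x + delta *: v in
  0 <= delta ->
  f2 (if tf1 y <= tf0 x then y else x)
    + delta * Num.max (- dot (grad f0 x) v) 0
  <= f0 x + L / 2 * delta ^+ 2 * (if dot (grad f0 x) v < 0 then sqnorm v else 0)
     + 2 * (d0 + d1 + b0 + b1).
Proof.
move=> sm d00 d10 b00 b10 f10 f21 tf0b tf1b y delta0.
have := smooth_descent L f0 sm x (delta *: v).
rewrite -/y dotZr sqnormZ => desc.
have /andP[? ?] : - d0 <= f1 x - f0 x <= d0 by rewrite -ler_norml.
have /andP[? ?] : - d0 <= f1 y - f0 y <= d0 by rewrite -ler_norml.
have /andP[? ?] : - d1 <= f2 x - f1 x <= d1 by rewrite -ler_norml.
have /andP[? ?] : - d1 <= f2 y - f1 y <= d1 by rewrite -ler_norml.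
have /andP[? ?] : - b0 <= tf0 x - f0 x <= b0 by rewrite -ler_norml.
have /andP[? ?] : - b1 <= tf1 y - f1 y <= b1 by rewrite -ler_norml.
case: ltP => [g0|g0].
  rewrite max_l; last by rewrite oppr_ge0 ltW.
  case: ifP => [|/negbT]; rewrite ?(-ltNge) => ?; lra.
rewrite max_r ?oppr_le0// mulr0 mulr0 !addr0.
by case: ifP => [|/negbT]; rewrite -?ltNge => ?; lra.
Qed.
End Pathwise.

(** * Conditioning on the past draws *)

Section Past.
Context {R : realType} {p : nat} {d : measure_display}
  {Omega : measurableType d}.
Variables (P : probability Omega R) (v : nat -> Omega -> 'rV[R]_p).

(** The sample space with the sigma-algebra of the past: measurability of a
    map on it expresses dependence on the draws before t only. *)
Definition past_space (t : nat) := g_sigma_algebraType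
  (\bigcup_(s in [set s | (s < t)%N && ~~ odd s])
     preimage_set_system setT (v s) borel).

Lemma measurable_past_le {d'} {T' : measurableType d'} (t t' : nat)
    (f : Omega -> T') :
  (t <= t')%N -> measurable_fun setT (f : past_space t -> T') ->
  measurable_fun setT (f : past_space t' -> T').
Proof.
move=> tt' mf _ A mA; have := mf measurableT A mA.
apply: sub_smallest2r; first exact: smallest_sigma_algebra.
move=> B [s /= /andP[st os] hB]; exists s => //=.
by rewrite (leq_trans st)//.
Qed.

Lemma measurable_past_draw t : ~~ odd t ->
  measurable_fun setT (v t : past_space t.+2 -> borelV R p).
Proof.
move=> ot _ A mA; apply: sub_sigma_algebra; exists t => /=.
  by rewrite ot ltnS leqnSn.
by exists A.
Qed.

Hypothesis gv : gaussian_directions P v.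

Lemma past_draws_measurable t : past_draws v t `<=` measurable.
Proof.
apply: smallest_sub; first exact: sigma_algebra_measurable.
move=> _ [s /= /andP[_ os] [B mB <-]]; rewrite setTI.
exact: (gv s os).1.1.
Qed.

Lemma measurable_past_id t : measurable_fun setT (id : Omega -> past_space t).
Proof. by move=> _ A mA; rewrite setTI; exact: past_draws_measurable mA. Qed.

Lemma measurable_integral_past t (F : past_space t * borelV R p -> \bar R) :
  ~~ odd t -> measurable_fun setT F -> (forall z, 0 <= F z)%E ->
  measurable_fun setT (fun w : Omega => \int[P]_w' F (w, v t w'))%E.
Proof.
move=> ot mF F0; have mv := measurable_gaussian _ _ _ (gv t ot).1.
rewrite (_ : (fun w => _) =
    (fun w => \int[image_prob P _ mv]_x F (w, x))%E); last first.
  apply/funext => w; rewrite ge0_integral_image_prob//.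
  exact: (measurableT_comp mF
    (@pair1_measurable _ _ (past_space t) (borelV R p) w)).
exact: (measurableT_comp (@measurable_fun_fubini_tonelli_F _ _ (past_space t)
  (borelV R p) R (image_prob P _ mv) _ mF F0) (measurable_past_id t)).
Qed.

(** The identity into [past_space t] and v t are independent, so their joint
    law is a product: in F(w, v t w) the two occurrences of w may be drawn
    independently. *)
Lemma ge0_integral_past t (F : past_space t * borelV R p -> \bar R) :
  ~~ odd t -> measurable_fun setT F -> (forall z, 0 <= F z)%E ->
  (\int[P]_w F (w, v t w) = \int[P]_w \int[P]_w' F (w, v t w'))%E.
Proof.
move=> ot mF F0.
have [giso indep] := gv t ot.
have mid := measurable_past_id t.
have mv := measurable_gaussian _ _ _ giso.
rewrite (@ge0_integral_joint _ _ _ Omega (past_space t) (borelV R p) R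
  P _ _ mid mv (image_prob P _ mid) (image_prob P _ mv) _ F mF F0); last first.
  move=> A B mA mB; rewrite setIC muleC.
  apply: indep => //; exists B => //; by rewrite setTI.
rewrite ge0_integral_image_prob; last 2 first.
- exact: measurable_fun_fubini_tonelli_F mF F0.
- by move=> w; apply: integral_ge0.
apply: eq_integral => w _; rewrite ge0_integral_image_prob//.
exact: (measurableT_comp mF
  (@pair1_measurable _ _ (past_space t) (borelV R p) w)).
Qed.
End Past.

(** * Expected descent along the search *)

Section Search.
Context {R : realType} {p : nat} {d : measure_display}
  {Omega : measurableType d}.
Variables (P : probability Omega R) (L : R) (Phi tPhi : nat -> 'rV[R]_p -> R)
  (Philow : R) (u0 : 'rV[R]_p) (delta : nat -> R)
  (v u : nat -> Omega -> 'rV[R]_p).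
Hypotheses (p_gt0 : (0 < p)%N) (L_gt0 : 0 < L)
  (smPhi : forall t, smooth L (Phi t))
  (lbPhi : forall t x, Philow <= Phi t x)
  (ctPhi : forall t, continuous (tPhi t))
  (ubD : forall t, has_ubound (gaps (Phi t.+1) (Phi t)))
  (ubB : forall t, has_ubound (gaps (tPhi t) (Phi t)))
  (gv : gaussian_directions P v)
  (delta_ge0 : forall t, 0 <= delta t)
  (ds : direct_search tPhi u0 delta v u).

Let ps t := past_space v t.

(** Continuity of the oracles makes the acceptance test a measurable event. *)
Lemma iterate_past_measurable n i :
  measurable_fun setT (fun w : ps n.*2 => u n.*2 w 0 i).
Proof.
elim: n i => [|n IH] i.
  rewrite (_ : (fun w => _) = cst (u0 0 i)); first exact: measurable_cst.
  by apply/funext => w; rewrite /= (ds_init ds).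
have en : ~~ odd n.*2 by rewrite odd_double.
rewrite doubleS.
have mu j : measurable_fun setT (fun w : ps n.*2.+2 => u n.*2 w 0 j).
  by apply: measurable_past_le (IH j); rewrite leqW// leqW.
have mv j : measurable_fun setT (fun w : ps n.*2.+2 => v n.*2 w 0 j).
  have mc := continuous_measurable_row _ (@coord_continuous R 1 p 0 j).
  exact: (measurableT_comp mc (measurable_past_draw v n.*2 en)).
have mu1 j : measurable_fun setT (fun w : ps n.*2.+2 => u n.*2.+1 w 0 j).
  rewrite (_ : (fun w => _) = fun w : ps n.*2.+2 =>
      u n.*2 w 0 j + delta n.*2 * v n.*2 w 0 j); last first.
    by apply/funext => w; rewrite (ds_probe ds)// !mxE.
  by apply: measurable_funD => //; exact: measurable_funM.
rewrite (_ : (fun w => _) = fun w : ps n.*2.+2 =>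
    if tPhi n.*2.+1 (u n.*2.+1 w) <= tPhi n.*2 (u n.*2 w)
    then u n.*2.+1 w 0 i else u n.*2 w 0 i); last first.
  by apply/funext => w; rewrite (ds_update ds)//; case: ifP.
apply: measurable_fun_ifT => //.
apply: measurable_fun_ler.
- exact: (measurableT_comp (continuous_measurable_row _ (ctPhi _))
    (measurable_row _ mu1)).
- exact: (measurableT_comp (continuous_measurable_row _ (ctPhi _))
    (measurable_row _ mu)).
Qed.

Let g n w := grad (Phi n.*2) (u n.*2 w).

Let miter n : measurable_fun setT (u n.*2 : ps n.*2 -> borelV R p).
Proof. by apply: measurable_row => i; exact: iterate_past_measurable. Qed.

Let mg n i : measurable_fun setT (fun w : ps n.*2 => g n w 0 i).
Proof.
have mc := continuous_measurable_row _
  (smooth_grad_continuous _ _ (smPhi n.*2) i).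
exact: (measurableT_comp mc (miter n)).
Qed.

(** The ratio E <a,v>^- / |a| for v ~ N(0, I/p). *)
Let kappa : R := (Num.sqrt (2 * pi * p%:R))^-1.

Let pV_gt0 : 0 < p%:R^-1 :> R. Proof. by rewrite invr_gt0 ltr0n. Qed.

Let mdot n : measurable_fun setT
  (fun z : ps n.*2 * borelV R p => dot (g n z.1) (z.2 : 'rV[R]_p)).
Proof.
apply: measurable_sumR => i; apply: measurable_funM.
  exact: (measurableT_comp (mg n i)
    (@measurable_fst _ _ (ps n.*2) (borelV R p))).
have mc := continuous_measurable_row _ (@coord_continuous R 1 p 0 i).
exact: (measurableT_comp mc (@measurable_snd _ _ (ps n.*2) (borelV R p))).
Qed.

Let msq n : measurable_fun setT
  (fun z : ps n.*2 * borelV R p => sqnorm (z.2 : 'rV[R]_p)).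
Proof.
apply: measurable_sumR => i; apply: measurable_funX.
have mc := continuous_measurable_row _ (@coord_continuous R 1 p 0 i).
exact: (measurableT_comp mc (@measurable_snd _ _ (ps n.*2) (borelV R p))).
Qed.

Lemma expected_descent n :
  (\int[P]_w (Num.max (- dot (g n w) (v n.*2 w)) 0)%:E =
   \int[P]_w (kappa * enorm (g n w))%:E)%E.
Proof.
have en : ~~ odd n.*2 by rewrite odd_double.
rewrite (ge0_integral_past P v gv n.*2
  (fun z => (Num.max (- dot (g n z.1) (z.2 : 'rV[R]_p)) 0)%:E) en).
- apply: eq_integral => w _ /=.
  rewrite (integral_gaussian_dot_negpart P p%:R^-1)//; last first.
    exact: (gv n.*2 en).1.
  rewrite mulrC sqrtrV ?ler0n// -invfM -sqrtrM ?ler0n//.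
  by rewrite (mulrC p%:R).
- apply/measurable_EFinP; apply: measurable_maxr => //.
  by apply: measurableT_comp => //; exact: mdot.
- by move=> z; rewrite lee_fin le_max lexx orbT.
Qed.

Lemma expected_curvature_le n :
  (\int[P]_w (if dot (g n w) (v n.*2 w) < 0 then sqnorm (v n.*2 w) else 0)%:E
    <= (1 / 2)%:E)%E.
Proof.
have en : ~~ odd n.*2 by rewrite odd_double.
pose F (z : ps n.*2 * borelV R p) : \bar R :=
  (if dot (g n z.1) (z.2 : 'rV[R]_p) < 0
   then sqnorm (z.2 : 'rV[R]_p) else 0)%:E.
have F0 z : (0 <= F z)%E.
  by rewrite lee_fin; case: ifP => // _; exact: sqnorm_ge0.
have mF : measurable_fun setT F.
  apply/measurable_EFinP; apply: measurable_fun_ifT => //.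
  by apply: measurable_fun_ltr => //; exact: mdot.
rewrite (ge0_integral_past P v gv n.*2 F en)//.
apply: (@le_trans _ _ (\int[P]_w (1 / 2)%:E)%E).
  apply: ge0_le_integral => //.
  - by move=> w _; apply: integral_ge0 => w' _; exact: F0.
  - exact: measurable_integral_past.
  - move=> w _.
    have := integral_gaussian_halfspace_sqnorm_le P p%:R^-1 (v n.*2) pV_gt0
      (gv n.*2 en).1 (g n w).
    by rewrite mulfV ?pnatr_eq0 -?lt0n.
by rewrite integral_cst_prob.
Qed.

Let mPhi n : measurable_fun setT (fun w : Omega => Phi n.*2 (u n.*2 w)).
Proof.
have mc := continuous_measurable_row _ (smooth_continuous _ _ (smPhi n.*2)).
exact: (measurableT_comp (measurableT_comp mc (miter n))
  (measurable_past_id P v gv n.*2)).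
Qed.

Let mgO n i : measurable_fun setT (fun w : Omega => g n w 0 i).
Proof. exact: (measurableT_comp (mg n i) (measurable_past_id P v gv n.*2)). Qed.

Let mvO n i : measurable_fun setT (fun w : Omega => v n.*2 w 0 i).
Proof.
have en : ~~ odd n.*2 by rewrite odd_double.
exact: (measurable_gaussian_coord _ _ _ (gv n.*2 en).1).
Qed.

Let mdotO n : measurable_fun setT (fun w : Omega => dot (g n w) (v n.*2 w)).
Proof. by apply: measurable_sumR => i; exact: measurable_funM. Qed.

Let menorm n : measurable_fun setT (fun w : Omega => enorm (g n w)).
Proof.
have ms : measurable_fun setT (@Num.sqrt R).
  by apply: continuous_measurable_fun; exact: sqrt_continuous.
apply: (measurableT_comp ms).
by apply: measurable_sumR => i; exact: measurable_funX.
Qed.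

Let dB t := supdist (Phi t.+1) (Phi t) + supdist (tPhi t) (Phi t).

Let gapt n w := Phi n.*2 (u n.*2 w) - Philow.

(** Written as a sum bounded by a sum, with both objective gaps measured from
    Philow, so that all integrands are nonnegative. *)
Lemma expected_step_le n :
  (\int[P]_w (gapt n.+1 w)%:E
     + \int[P]_w (delta n.*2 * kappa * enorm (g n w))%:E
   <= \int[P]_w (gapt n w)%:E
     + (L / 4 * delta n.*2 ^+ 2 + 2 * (dB n.*2 + dB n.*2.+1))%:E)%E.
Proof.
have en : ~~ odd n.*2 by rewrite odd_double.
have dB0 t : 0 <= dB t by rewrite addr_ge0 ?supdist_ge0.
have gap0 m w : (0 <= (gapt m w)%:E)%E by rewrite lee_fin subr_ge0.
have mgap m : measurable_fun setT (fun w => (gapt m w)%:E).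
  by apply/measurable_EFinP; exact: measurable_funB.
pose M w := Num.max (- dot (g n w) (v n.*2 w)) 0.
pose Q w := if dot (g n w) (v n.*2 w) < 0 then sqnorm (v n.*2 w) else 0.
have M0 w : 0 <= M w by rewrite le_max lexx orbT.
have Q0 w : 0 <= Q w by rewrite /Q; case: ifP => // _; exact: sqnorm_ge0.
have mM : measurable_fun setT M.
  by apply: measurable_maxr => //; exact: measurableT_comp.
have mQ : measurable_fun setT Q.
  apply: measurable_fun_ifT => //; first exact: measurable_fun_ltr.
  by apply: measurable_sumR => i; exact: measurable_funX.
have kappa0 : 0 <= kappa by rewrite invr_ge0 sqrtr_ge0.
have -> : (\int[P]_w (delta n.*2 * kappa * enorm (g n w))%:E =
    \int[P]_w (delta n.*2 * M w)%:E)%E.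
  under eq_integral do rewrite -mulrA EFinM.
  under [RHS]eq_integral do rewrite EFinM.
  have mkE : measurable_fun setT (fun w => (kappa * enorm (g n w))%:E).
    by apply/measurable_EFinP; exact: measurable_funM.
  have mME : measurable_fun setT (fun w => (M w)%:E) by exact/measurable_EFinP.
  have kE0 w : setT w -> (0 <= (kappa * enorm (g n w))%:E)%E.
    by rewrite lee_fin mulr_ge0// enorm_ge0.
  have M0E w : setT w -> (0 <= (M w)%:E)%E by rewrite lee_fin.
  rewrite (ge0_integralZl _ measurableT mkE kE0 _); last by rewrite lee_fin.
  rewrite (ge0_integralZl _ measurableT mME M0E _); last by rewrite lee_fin.
  by rewrite expected_descent.
have mdM : measurable_fun setT (fun w => (delta n.*2 * M w)%:E).
  by apply/measurable_EFinP; exact: measurable_funM.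
have mcQ : measurable_fun setT
    (fun w => (L / 2 * delta n.*2 ^+ 2)%:E * (Q w)%:E)%E.
  by apply: measurable_funeM; exact/measurable_EFinP.
have L2 : 0 <= L / 2 * delta n.*2 ^+ 2.
  by rewrite mulr_ge0 ?sqr_ge0// divr_ge0// ltW.
have cQ0 w : (0 <= (L / 2 * delta n.*2 ^+ 2)%:E * (Q w)%:E)%E.
  by rewrite -EFinM lee_fin mulr_ge0.
rewrite -ge0_integralD//; last first.
  by move=> w _; rewrite lee_fin mulr_ge0.
pose c := 2 * (dB n.*2 + dB n.*2.+1).
apply: (@le_trans _ _ (\int[P]_w ((gapt n w)%:E +
   ((L / 2 * delta n.*2 ^+ 2)%:E * (Q w)%:E + c%:E)))%E).
  apply: ge0_le_integral => //.
  - by move=> w _; rewrite adde_ge0// lee_fin mulr_ge0.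
  - exact: emeasurable_funD.
  - apply: emeasurable_funD => //; exact: emeasurable_funD.
  move=> w _; rewrite -EFinM -!EFinD lee_fin /gapt doubleS (ds_update ds)//.
  rewrite (ds_probe ds)//.
  have := @direct_search_step R p L (delta n.*2)
    (supdist (Phi n.*2.+1) (Phi n.*2)) (supdist (Phi n.*2.+2) (Phi n.*2.+1))
    (supdist (tPhi n.*2) (Phi n.*2)) (supdist (tPhi n.*2.+1) (Phi n.*2.+1))
    (Phi n.*2) (Phi n.*2.+1) (Phi n.*2.+2) (tPhi n.*2) (tPhi n.*2.+1)
    (u n.*2 w) (v n.*2 w) (smPhi _)
    (supdist_ge0 _ _ (ubD _)) (supdist_ge0 _ _ (ubD _))
    (supdist_ge0 _ _ (ubB _)) (supdist_ge0 _ _ (ubB _))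
    (fun y => le_supdist _ _ y (ubD _)) (fun y => le_supdist _ _ y (ubD _))
    (fun y => le_supdist _ _ y (ubB _)) (fun y => le_supdist _ _ y (ubB _))
    (delta_ge0 _).
  rewrite /c /dB /M /Q /g /=; lra.
have c0 : 0 <= c by rewrite mulr_ge0// addr_ge0.
rewrite ge0_integralD//; last 2 first.
  by move=> w _; rewrite adde_ge0.
  exact: emeasurable_funD.
rewrite leeD2l// ge0_integralD// integral_cst_prob EFinD leeD2r//.
rewrite ge0_integralZl//; last 2 first.
  exact/measurable_EFinP.
  by move=> w _; rewrite lee_fin.
apply: (le_trans (lee_wpmul2l _ (expected_curvature_le n))).
  by rewrite lee_fin.
by rewrite -EFinM lee_fin; lra.
Qed.

Let scaled_grad t w := (delta t * kappa * enorm (grad (Phi t) (u t w)))%:E.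

Lemma telescoped_descent_le n :
  (\int[P]_w (gapt n w)%:E + \sum_(t < n.*2 | ~~ odd t) \int[P]_w scaled_grad t w
   <= (Phi 0%N u0 - Philow + \sum_(t < n.*2 | ~~ odd t) L / 4 * delta t ^+ 2
       + 2 * drift Phi n.*2 + 2 * oracle_err tPhi Phi n.*2)%:E)%E.
Proof.
elim: n => [|n IH].
  rewrite double0 /drift /oracle_err !big_ord0 !mulr0 !addr0.
  rewrite (eq_integral (fun=> (Phi 0%N u0 - Philow)%:E)) ?integral_cst_prob//.
  by move=> w _; rewrite /gapt/= (ds_init ds).
have en : odd n.*2 = false by rewrite odd_double.
have sum2 (F : nat -> R) : \sum_(t < n.+1.*2 | ~~ odd t) F t =
    \sum_(t < n.*2 | ~~ odd t) F t + F n.*2.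
  rewrite doubleS big_mkcond 2!big_ord_recr/= en/= addr0 -big_mkcond//.
have sume2 (F : nat -> \bar R) : (\sum_(t < n.+1.*2 | ~~ odd t) F t =
    \sum_(t < n.*2 | ~~ odd t) F t + F n.*2)%E.
  rewrite doubleS big_mkcond 2!big_ord_recr/= en/= adde0 -big_mkcond//.
rewrite (sum2 (fun t => L / 4 * delta t ^+ 2)).
rewrite (sume2 (fun t => \int[P]_w scaled_grad t w)%E) addeCA.
apply: (le_trans (leeD2l _ (expected_step_le n))).
rewrite addeA [(_ + \int[P]_w (gapt n w)%:E)%E]addeC.
apply: (le_trans (leeD2r _ IH)).
rewrite -EFinD lee_fin /drift /oracle_err doubleS !big_ord_recr/= /dB.
lra.
Qed.

(** Since m <= delta t, |grad|^2 <= G |grad| <= (G / m) delta_t |grad|, and the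
    telescoped inequality controls the sum of the latter. *)
Lemma R1_even_le (G m : R) n : 0 < G -> 0 < m ->
  (forall t x, enorm (grad (Phi t) x) <= G) ->
  (forall t, (t < n.*2)%N -> m <= delta t) ->
  (R1_even P Phi u n.*2 <= (G * Num.sqrt (2 * pi * p%:R) / m *
    (Phi 0%N u0 - Philow + \sum_(t < n.*2 | ~~ odd t) L / 4 * delta t ^+ 2
       + 2 * drift Phi n.*2 + 2 * oracle_err tPhi Phi n.*2))%:E)%E.
Proof.
move=> G0 m0 gG md.
set K := G * _ / m.
have sq0 : 0 < Num.sqrt (2 * pi * p%:R) :> R.
  by rewrite sqrtr_gt0 !mulr_gt0 ?pi_gt0 ?ltr0n.
have K0 : 0 < K by rewrite divr_gt0// mulr_gt0.
rewrite EFinM; apply: (@le_trans _ _ (K%:E *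
    (\sum_(t < n.*2 | ~~ odd t) \int[P]_w scaled_grad t w))%E); last first.
  apply: lee_wpmul2l; first by rewrite lee_fin ltW.
  apply: le_trans (telescoped_descent_le n); rewrite leeDr//.
  by apply: integral_ge0 => w _; rewrite lee_fin subr_ge0.
have step0 t w : (0 <= scaled_grad t w)%E.
  by rewrite lee_fin !mulr_ge0 ?enorm_ge0// invr_ge0 ltW.
rewrite ge0_sume_distrr; last first.
  by move=> t _; apply: integral_ge0 => w _; exact: step0.
rewrite /R1_even; apply: lee_sum => t et.
have [k tk] : exists k, t = k.*2 :> nat.
  by exists (t : nat)./2; rewrite -[LHS]odd_double_half (negbTE et).
rewrite unlock tk.
have mE : measurable_fun setT (fun w => enorm (grad (Phi k.*2) (u k.*2 w))).
  exact: menorm.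
have mS : measurable_fun setT (scaled_grad k.*2).
  by apply/measurable_EFinP; exact: measurable_funM.
rewrite -ge0_integralZl//; last by rewrite lee_fin ltW.
apply: ge0_le_integral => //.
- by move=> w _; rewrite lee_fin sqr_ge0.
- by apply/measurable_EFinP; exact: measurable_funX.
- exact: measurable_funeM.
move=> w _; rewrite -EFinM lee_fin expr2.
have e0 := enorm_ge0 (grad (Phi k.*2) (u k.*2 w)).
have -> : K * (delta k.*2 * kappa * enorm (grad (Phi k.*2) (u k.*2 w))) =
    G * (delta k.*2 / m) * enorm (grad (Phi k.*2) (u k.*2 w)).
  by rewrite /K /kappa; field; rewrite !gt_eqF.
have dm : 1 <= delta k.*2 / m by rewrite ler_pdivlMr// mul1r md// -tk.
by rewrite ler_wpM2r// (le_trans (gG _ _))// ler_peMr// ltW.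
Qed.

End Search.

(** * Sums over even times *)

Section EvenSums.
Context {R : realType}.

Lemma sum_even_const (c : R) n : \sum_(t < n.*2 | ~~ odd t) c = n%:R * c.
Proof.
elim: n => [|n IH]; first by rewrite big_ord0 mul0r.
rewrite doubleS big_mkcond 2!big_ord_recr/= odd_double/= addr0 -big_mkcond/=.
by rewrite IH -natr1 mulrDl mul1r.
Qed.

(** Inductive step: e^(-x) >= 1 - x at x = 1/(n+2) says that 1/(n+2) is at most
    ln (n+2) - ln (n+1). *)
Lemma harmonic_le_ln n : \sum_(t < n.+1) (t.+1%:R)^-1 <= 1 + ln n.+1%:R :> R.
Proof.
elim: n => [|n IH]; first by rewrite big_ord1 ln1 addr0 invr1.
rewrite big_ord_recr/= (le_trans (lerD IH (lexx _)))// -addrA lerD2l.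
have n1 : 0 < n.+1%:R :> R by rewrite ltr0n.
have n2 : 0 < n.+2%:R :> R by rewrite ltr0n.
rewrite -lerBrDr -ler_expR lnK ?posrE// expRD lnK ?posrE//.
rewrite mulrC -ler_pdivrMr//.
apply: le_trans (expR_ge1Dx _).
rewrite ler_pdivrMr// mulrDl mul1r mulNr mulVf ?gt_eqF//.
by rewrite -[n.+2%:R]natr1 addrK.
Qed.

Lemma sum_even_harmonic_le n : (0 < n)%N ->
  \sum_(t < n | ~~ odd t) (t.+1%:R)^-1 <= 1 + ln n%:R :> R.
Proof.
case: n => // n _; apply: le_trans (harmonic_le_ln n).
rewrite big_mkcond; apply: ler_sum => t _.
by case: ifP => // _; rewrite invr_ge0 ler0n.
Qed.
End EvenSums.

(** * The regret bounds *)

(* The constants (c1, T1), (c2, T2) hidden by the two O(.) depend on L, G and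
   the initial gap Phi_0(u0) - Phi_low only: they are uniform in the dimension p,
   in eps, and in the drift and oracle errors. *)
Theorem proposition3p8 (R : realType) (L G gap : R) (L_gt0 : 0 < L)
    (G_gt0 : 0 < G) :
  exists (c1 c2 : R) (T1 T2 : nat), [/\ 0 < c1, 0 < c2 &
  forall (p : nat) (d : measure_display) (Omega : measurableType d)
    (P : probability Omega R)
    (Phi tPhi : nat -> 'rV[R]_p -> R) (Philow : R)
    (u0 : 'rV[R]_p) (v : nat -> Omega -> 'rV[R]_p),
  (0 < p)%N ->
  (forall t, smooth L (Phi t)) ->
  (forall t u, Philow <= Phi t u) ->
  (forall t, continuous (tPhi t)) ->
  (forall t, has_ubound (gaps (Phi t.+1) (Phi t))) ->
  (forall t, has_ubound (gaps (tPhi t) (Phi t))) ->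
  (forall t u, enorm (grad (Phi t) u) <= G) ->
  Phi 0%N u0 - Philow = gap ->
  gaussian_directions P v ->
  let D := drift Phi in
  let B := oracle_err tPhi Phi in
  [/\ (* constant probing *)
      forall (delta : R) (u : nat -> Omega -> 'rV[R]_p), 0 < delta ->
        direct_search tPhi u0 (fun=> delta) v u ->
        forall T, ~~ odd T -> (2 <= T)%N ->
        (R1_even P Phi u T <=
          (G * Num.sqrt (2 * pi * p%:R) *
            ((Phi 0%N u0 - Philow + 2 * D T + 2 * B T) / delta
             + L / 8 * T%:R * delta))%:E)%E,
      forall (eps : R) (u : nat -> Omega -> 'rV[R]_p), 0 < eps ->
        direct_search tPhi u0
          (fun=> 4 * eps / (3 * Num.sqrt (2 * pi * p%:R) * L)) v u ->
        forall T, ~~ odd T -> (2 <= T)%N -> (T1 <= T)%N ->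
        (R1_even P Phi u T <=
          (c1 * (T%:R * eps + p%:R * (1 + D T + B T) / eps))%:E)%E,
      (* diminishing probing *)
      forall u : nat -> Omega -> 'rV[R]_p,
        direct_search tPhi u0 (fun t => (Num.sqrt t.+1%:R)^-1) v u ->
        forall T, ~~ odd T -> (2 <= T)%N ->
        (R1_even P Phi u T <=
          (G * Num.sqrt (2 * pi * p%:R * T%:R) *
            (Phi 0%N u0 - Philow + L / 4 * (1 + ln T%:R)
             + 2 * D T + 2 * B T))%:E)%E &
      forall u : nat -> Omega -> 'rV[R]_p,
        direct_search tPhi u0 (fun t => (Num.sqrt t.+1%:R)^-1) v u ->
        forall T, ~~ odd T -> (2 <= T)%N -> (T2 <= T)%N ->
        (R1_even P Phi u T <=
          (c2 * (Num.sqrt (p%:R * T%:R) * (ln T%:R + D T + B T)))%:E)%E]].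
Proof.
(* c1 and c2 collect the coefficients left after inserting the step size, with
   gap + 2 D + 2 B <= (|gap| + 2) (1 + D + B) for c1; for c2, ln T >= ln 2
   absorbs the terms that do not grow with T. *)
pose c1 := G / 6 + 3 / 2 * pi * G * L * (`|gap| + 2).
pose k2 := (`|gap| + L / 4) / ln 2 + L / 4 + 2.
pose c2 := G * Num.sqrt (2 * pi) * k2.
have pi0 : 0 < pi :> R := pi_gt0 R.
have ln2 : 0 < ln 2 :> R by rewrite ln_gt0// ltr1n.
have L4 : 0 <= L / 4 by rewrite divr_ge0// ltW.
have A0 : 0 <= (`|gap| + L / 4) / ln 2 by rewrite divr_ge0 ?addr_ge0// ltW.
have k2_gt0 : 0 < k2 by rewrite /k2; lra.
have c1_gt0 : 0 < c1.
  rewrite ltr_pwDl ?divr_gt0// mulr_ge0 ?addr_ge0//.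
  by rewrite ltW// !(mulr_gt0, divr_gt0).
have c2_gt0 : 0 < c2 by rewrite !mulr_gt0// sqrtr_gt0 mulr_gt0.
exists c1, c2, 0%N, 0%N; split => //.
move=> p d Omega P Phi tPhi Philow u0 v p_gt0 smPhi lbPhi ctPhi ubD ubB gG.
move=> gapE gv D B.
have p0 : 0 < p%:R :> R by rewrite ltr0n.
pose q : R := Num.sqrt (2 * pi * p%:R).
have q0 : 0 < q by rewrite sqrtr_gt0 !mulr_gt0.
have q2 : q ^+ 2 = 2 * pi * p%:R by rewrite sqr_sqrtr// !mulr_ge0// ltW.
have D0 T : 0 <= D T by apply: sumr_ge0 => t _; exact: supdist_ge0.
have B0 T : 0 <= B T by apply: sumr_ge0 => t _; exact: supdist_ge0.
have gap0 : gap <= `|gap| by exact: ler_norm.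
have evenT T : ~~ odd T -> T = T./2.*2.
  by move=> oT; rewrite -[LHS]odd_double_half (negbTE oT).
have constant (delta : R) (u : nat -> Omega -> 'rV[R]_p) : 0 < delta ->
    direct_search tPhi u0 (fun=> delta) v u ->
    forall T, ~~ odd T -> (2 <= T)%N ->
    (R1_even P Phi u T <= (G * q *
            ((Phi 0%N u0 - Philow + 2 * D T + 2 * B T) / delta
             + L / 8 * T%:R * delta))%:E)%E.
  move=> delta0 ds T oT _; rewrite (evenT T oT); set n := T./2.
  have := R1_even_le P L Phi tPhi Philow u0 (fun=> delta) v u p_gt0 L_gt0
    smPhi lbPhi ctPhi ubD ubB gv (fun=> ltW delta0) ds G delta n G_gt0 delta0
    gG (fun _ _ => lexx _).
  rewrite sum_even_const -/q => /le_trans; apply.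
  rewrite lee_fin le_eqVlt; apply/orP; left; apply/eqP.
  rewrite -muln2 natrM -/(D _) -/(B _) /D /B muln2; field.
  by rewrite gt_eqF.
have diminishing (u : nat -> Omega -> 'rV[R]_p) :
    direct_search tPhi u0 (fun t => (Num.sqrt t.+1%:R)^-1) v u ->
    forall T, ~~ odd T -> (2 <= T)%N ->
    (R1_even P Phi u T <=
      (G * Num.sqrt (2 * pi * p%:R * T%:R) *
        (Phi 0%N u0 - Philow + L / 4 * (1 + ln T%:R) + 2 * D T + 2 * B T))%:E)%E.
  move=> ds T oT T2.
  have T0 : 0 < T%:R :> R by rewrite ltr0n (leq_trans _ T2).
  have sT0 : 0 < Num.sqrt T%:R :> R by rewrite sqrtr_gt0.
  have st0 t : 0 < Num.sqrt t.+1%:R :> R by rewrite sqrtr_gt0 ltr0n.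
  have := R1_even_le P L Phi tPhi Philow u0 (fun t => (Num.sqrt t.+1%:R)^-1) v u
    p_gt0 L_gt0 smPhi lbPhi ctPhi ubD ubB gv _ ds G
    (Num.sqrt T%:R)^-1 T./2 G_gt0 _ gG _.
  rewrite -evenT// => /(_ _ _ _)/le_trans; apply.
  - by move=> t; rewrite invr_ge0 ltW.
  - by rewrite invr_gt0.
  - by move=> t tT; rewrite lef_pV2 ?posrE// ler_wsqrtr// ler_nat.
  have -> : Num.sqrt (2 * pi * p%:R * T%:R) = q * Num.sqrt T%:R :> R.
    by rewrite /q -sqrtrM// ltW// !mulr_gt0.
  rewrite lee_fin invrK (mulrA G).
  rewrite ler_wpM2l//; first by rewrite ltW// !mulr_gt0.
  rewrite !lerD2r lerD2l -mulr_sumr ler_wpM2l//.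
  apply: le_trans (sum_even_harmonic_le T _); last by rewrite (leq_trans _ T2).
  apply: ler_sum => t _.
  by rewrite exprVn sqr_sqrtr.
split => //.
- move=> eps u eps0 ds T oT T2 _.
  have L0 : L != 0 by rewrite gt_eqF.
  have delta0 : 0 < 4 * eps / (3 * q * L) by rewrite divr_gt0 ?mulr_gt0.
  apply: (le_trans (constant _ u delta0 ds T oT T2)); rewrite lee_fin gapE.
  have -> : G * q * ((gap + 2 * D T + 2 * B T) / (4 * eps / (3 * q * L)) +
      L / 8 * T%:R * (4 * eps / (3 * q * L))) =
    G / 6 * (T%:R * eps) +
    3 / 2 * pi * G * L * (gap + 2 * D T + 2 * B T) * (p%:R / eps).
    (* q enters once through the prefactor and once through 1 / delta *)
    transitivity (G / 6 * (T%:R * eps) +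
      q ^+ 2 * (3 / 4 * G * L * (gap + 2 * D T + 2 * B T) / eps)).
      by field; rewrite !gt_eqF.
    by rewrite q2; field; rewrite gt_eqF.
  have pe0 : 0 <= p%:R / eps by rewrite divr_ge0// ltW.
  have K0 : 0 <= 3 / 2 * pi * G * L by rewrite ltW// !(mulr_gt0, divr_gt0).
  have Te0 : 0 <= T%:R * eps by rewrite mulr_ge0// ltW.
  have g0 := normr_ge0 gap; have DT := D0 T; have BT := B0 T.
  have le1 : gap + 2 * D T + 2 * B T <= (`|gap| + 2) * (1 + D T + B T) by nra.
  have le2 := ler_wpM2r pe0 (ler_wpM2l K0 le1).
  apply: (le_trans (lerD (lexx _) le2)).
  rewrite /c1 -subr_ge0.
  rewrite [X in 0 <= X](_ : _ = G / 6 * ((1 + D T + B T) * (p%:R / eps)) +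
    3 / 2 * pi * G * L * (`|gap| + 2) * (T%:R * eps)); last first.
    by field; rewrite gt_eqF.
  have G6 : 0 <= G / 6 by rewrite ltW// divr_gt0.
  by rewrite addr_ge0// mulr_ge0// mulr_ge0// !addr_ge0.
- move=> u ds T oT T2 _.
  apply: (le_trans (diminishing u ds T oT T2)); rewrite lee_fin gapE.
  have lnT : ln 2 <= ln T%:R :> R.
    by rewrite ler_ln ?posrE// ?ler_nat// ltr0n (leq_trans _ T2).
  have -> : Num.sqrt (2 * pi * p%:R * T%:R) =
      Num.sqrt (2 * pi) * Num.sqrt (p%:R * T%:R) :> R.
    by rewrite -sqrtrM ?mulr_ge0 ?(ltW pi0)// mulrA.
  set X := gap + _ + _ + _; set Y := ln _ + _ + _.
  suff XY : X <= k2 * Y.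
    have Z0 : 0 <= G * (Num.sqrt (2 * pi) * Num.sqrt (p%:R * T%:R)).
      by rewrite ltW// !mulr_gt0 ?sqrtr_gt0 ?mulr_gt0// ltr0n (leq_trans _ T2).
    apply: (le_trans (ler_wpM2l Z0 XY)).
    by rewrite le_eqVlt /c2; apply/orP; left; apply/eqP; ring.
  rewrite /X /Y.
  have DT := D0 T; have BT := B0 T; have g0 := normr_ge0 gap.
  have : `|gap| + L / 4 <= (`|gap| + L / 4) / ln 2 * ln T%:R.
    have r1 : 1 <= ln T%:R / ln 2 :> R by rewrite ler_pdivlMr// mul1r.
    by rewrite mulrAC -mulrA ler_peMr// addr_ge0.
  rewrite /k2; have : 0 <= ln T%:R :> R by rewrite (le_trans _ lnT)// ltW.
  nra.
Qed.
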